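(* Suppose the bottom is strictly monotone, i.e. either $\dot s(t)>0$ for all $t\in[0,T]$ or $\dot s(t)<0$ for all $t\in[0,T]$. Then the initial-boundary-value problem \begin{align*} &p_t=\tfrac{\mathrm{i}}{A(t)}\,p_{xx}+B(t,x)\,p_x+\big[B_x(t,x)+G(t,x)\big]p+G_x(t,x)\,\theta,\qquad (t,x)\in[0,T]\times[0,1],\\ &p_x(t,0)=0,\qquad t\in[0,T],\\ &\tfrac{\mathrm{i}}{A(t)}\,p_x(t,1)=\tfrac{1-R_1(t)B(t,1)}{R_1(t)}\,p(t,1)-\tfrac{R_1(t)G(t,1)+R_2(t)}{R_1(t)}\,\theta(t,1),\qquad t\in[0,T],\\ &p(0,x)=p_0(x),\qquad x\in[0,1], \end{align*} with $\theta(t,x)=\int_0^xp(t,\xi)\,d\xi$ and coefficients as defined in the context, is $L^2$-stable: there is a constant $C$, independent of $p_0$, such that every (sufficiently smooth) solution $p$ satisfies $$\|p(t,\cdot)\|_{L^2(0,1)}\le C\,\|p_0\|_{L^2(0,1)}\qquad\forall\,t\in[0,T].$$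
   Context: $T>0$; $s:[0,T]\to(0,\infty)$ is a smooth function (bottom profile), a dot denotes $d/dt$; $g:[0,T]\to\mathbb C$ and $\gamma(t,y)\in\mathbb C$ ($0\le y\le s(t)$, $0\le t\le T$) are given smooth functions; $w_0$ is a given smooth complex-valued function on $[0,s(0)]$. The unknown $p$ is complex-valued. Define $$\zeta(t,x)=\tfrac{\mathrm{i}}{2}\,(\sigma(t)-1)\,\dot s(t)s(t)\,x^2,$$ where $\sigma(t)=\frac{2(1+\dot s(t)^2)}{\dot s(t)^2}+\varepsilon$ with a fixed constant $\varepsilon>0$ if $\dot s(t)>0$, and $\sigma(t)=1$ (so $\zeta=0$) if $\dot s(t)<0$. Furthermore $A(t)=2s^2(t)$, $\;R_1(t)=\frac{\dot s(t)s(t)}{1+\dot s(t)^2}$, $\;B(t,x)=x\frac{\dot s(t)}{s(t)}-\frac{\mathrm{i}}{s^2(t)}\zeta_x(t,x)$ (so that $B(t,x)=x\frac{\dot s(t)}{s(t)}\sigma(t)$ is real-valued), $$G(t,x)=\zeta_t(t,x)-x\tfrac{\dot s(t)}{s(t)}\zeta_x(t,x)+\mathrm{i}\,\gamma(t,xs(t))+\tfrac{\mathrm{i}}{2s^2(t)}\big[(\zeta_x(t,x))^2-\zeta_{xx}(t,x)\big],$$ $R_2(t)=[g(t)-\zeta_t(t,1)]R_1(t)+\zeta_x(t,1)$, and $$p_0(x)=s(0)\exp(\zeta(0,x))\Big[w_0'(xs(0))+\zeta_x(0,x)\int_0^xw_0'(\xi s(0))\,d\xi\Big].$$ *)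

(* Defs.v *)
From Stdlib Require Import Reals Lra.
From Coquelicot Require Import Coquelicot.

Open Scope R_scope.

(* Functions on closed intervals are represented by total functions on [R] of
   which only the values on the interval matter: all derivatives are taken
   within the interval, hence one-sided at its end points. *)

Definition Icc (a b x : R) : Prop := a <= x <= b.

Definition is_derive_on {V : NormedModule R_AbsRing} (a b : R) (f : R -> V)
    (x : R) (l : V) : Prop :=
  filterdiff f (within (Icc a b) (locally x)) (fun h : R => scal h l).

Definition ex_derive_on {V : NormedModule R_AbsRing} (a b : R) (f : R -> V)
    (x : R) : Prop :=
  exists l : V, is_derive_on a b f x l.

(* As for [RInt], a total operator, meaningful when the derivative exists. *)
Definition Derive_on {V : CompleteNormedModule R_AbsRing} (a b : R)
    (f : R -> V) (x : R) : V :=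
  iota (is_derive_on a b f x).

Lemma minus_minus_minus {W : AbelianGroup} (u v w : W) :
  minus w v = minus (minus u v) (minus u w).
Proof.
rewrite (minus_trans u w v), plus_comm, <- (opp_minus u w); reflexivity.
Qed.

Lemma is_derive_on_unique {V : CompleteNormedModule R_AbsRing} (a b : R)
    (f : R -> V) (x : R) (l : V) :
  a < b -> Icc a b x -> is_derive_on a b f x l -> Derive_on a b f x = l.
Proof.
intros Hab Hx Hl; apply iota_unique; [|exact Hl]; intros l' Hl'.
assert (Hlim : is_filter_lim (within (Icc a b) (locally x)) x)
  by (apply filter_le_within).
destruct Hl as [_ Hl]; destruct Hl' as [_ Hl'].
specialize (Hl x Hlim); specialize (Hl' x Hlim).
assert (Hsmall : forall e : posreal, norm (minus l' l) <= 2 * e).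
{ intros e; specialize (Hl e); specialize (Hl' e).
  destruct (filter_and _ _ Hl Hl') as [d Hd]; unfold Icc in *.
  assert (Hy : exists y, a <= y <= b /\ y <> x /\ Rabs (y - x) < d).
  { pose proof (cond_pos d) as d0; destruct (Rle_lt_dec b x) as [Hbx|Hbx].
    - exists (x - Rmin (d / 2) (x - a)).
      assert (H1 := Rmin_l (d / 2) (x - a)); assert (H2 := Rmin_r (d / 2) (x - a)).
      assert (0 < Rmin (d / 2) (x - a)) by (apply Rmin_pos; lra).
      repeat split; try lra; rewrite Rabs_left; lra.
    - exists (x + Rmin (d / 2) (b - x)).
      assert (H1 := Rmin_l (d / 2) (b - x)); assert (H2 := Rmin_r (d / 2) (b - x)).
      assert (0 < Rmin (d / 2) (b - x)) by (apply Rmin_pos; lra).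
      repeat split; try lra; rewrite Rabs_right; lra. }
  destruct Hy as (y & Hy & Hne & Hyd).
  destruct (Hd y Hyd Hy) as [H1 H2].
  set (u := minus (f y) (f x)) in *; set (h := y - x) in *.
  change (norm (minus u (scal h l)) <= e * Rabs h) in H1.
  change (norm (minus u (scal h l')) <= e * Rabs h) in H2.
  assert (Hh : 0 < Rabs h) by (apply Rabs_pos_lt; unfold h; lra).
  assert (E : scal h (minus l' l)
              = minus (minus u (scal h l)) (minus u (scal h l'))).
  { etransitivity; [exact (scal_minus_distr_l (K := R_AbsRing) h l' l)|].
    exact (minus_minus_minus u (scal h l) (scal h l')). }
  apply (Rmult_le_reg_l (Rabs h)); [exact Hh|].
  apply Rle_trans with (norm (scal h (minus l' l))).
  { assert (Hk := norm_scal (K := R_AbsRing) (/ h) (scal h (minus l' l))).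
    rewrite scal_assoc in Hk.
    change (norm (scal (/ h * h) (minus l' l))
            <= Rabs (/ h) * norm (scal h (minus l' l))) in Hk.
    rewrite Rinv_l in Hk by (unfold h; lra).
    assert (E1 := scal_one (K := R_AbsRing) (minus l' l)).
    change (scal 1 (minus l' l) = minus l' l) in E1; rewrite E1 in Hk.
    rewrite Rabs_inv in Hk; apply (Rmult_le_compat_l (Rabs h)) in Hk; [|lra].
    rewrite <- Rmult_assoc, Rinv_r, Rmult_1_l in Hk; [exact Hk|lra]. }
  rewrite E.
  assert (Ht := norm_triangle (minus u (scal h l)) (opp (minus u (scal h l')))).
  assert (Ho := norm_opp (minus u (scal h l'))).
  apply (Rle_trans _ _ _ Ht).
  replace (Rabs h * (2 * e)) with (e * Rabs h + e * Rabs h) by ring.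
  apply Rplus_le_compat; [exact H1|].
  exact (Rle_trans _ _ _ (Req_le _ _ Ho) H2). }
assert (Hz : norm (minus l' l) = 0).
{ apply Rle_antisym; [|apply norm_ge_0].
  apply le_epsilon; intros e He.
  assert (H2 : 0 < e / 2) by lra.
  specialize (Hsmall (mkposreal _ H2)); simpl in Hsmall; lra. }
apply (plus_reg_r (opp l)); rewrite plus_opp_r.
exact (norm_eq_zero _ Hz).
Qed.

(* C^infinity on [a, b]: [D n] is the n-th derivative. *)
Definition smooth_on {V : NormedModule R_AbsRing} (a b : R) (f : R -> V) :
    Prop :=
  exists D : nat -> R -> V,
    (forall x, Icc a b x -> D O x = f x) /\
    (forall n x, Icc a b x -> is_derive_on a b (D n) x (D (S n) x)).

(* C^infinity on a closed planar region: [D i j] is the mixed partial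
   derivative of order [i] in the first and [j] in the second variable. The
   derivatives are Frechet derivatives within the region, up to its boundary. *)
Definition smooth_on2 (Omega : R * R -> Prop) (f : R -> R -> C) : Prop :=
  exists D : nat -> nat -> R * R -> C,
    (forall q, Omega q -> D O O q = f (fst q) (snd q)) /\
    (forall i j q, Omega q ->
      filterdiff (V := C_R_NormedModule) (D i j) (within Omega (locally q))
        (fun h : R * R =>
           plus (scal (V := C_R_NormedModule) (fst h) (D (S i) j q))
                (scal (V := C_R_NormedModule) (snd h) (D i (S j) q)))).

Definition rectangle (T : R) (q : R * R) : Prop :=
  Icc 0 T (fst q) /\ Icc 0 1 (snd q).

Definition profile_region (T : R) (s : R -> R) (q : R * R) : Prop :=
  Icc 0 T (fst q) /\ Icc 0 (s (fst q)) (snd q).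

Notation CDerive_on := (Derive_on (V := C_R_CompleteNormedModule)).
Notation CInt := (RInt (V := C_R_CompleteNormedModule)).

(* Partial derivatives within [0, T] x [0, 1]. *)
Definition Dt (T : R) (f : R -> R -> C) (t x : R) : C :=
  CDerive_on 0 T (fun tau => f tau x) t.
Definition Dx (f : R -> R -> C) (t x : R) : C :=
  CDerive_on 0 1 (f t) x.

Definition Cexp (z : C) : C :=
  (exp (Re z) * cos (Im z), exp (Re z) * sin (Im z)).

Definition L2norm (f : R -> C) : R :=
  sqrt (RInt (fun x => Cmod (f x) ^ 2) 0 1).

Definition sdot (T : R) (s : R -> R) (t : R) : R :=
  Derive_on (V := R_CompleteNormedModule) 0 T s t.

Definition sigma (T eps : R) (s : R -> R) (t : R) : R :=
  if Rlt_dec 0 (sdot T s t)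
  then 2 * (1 + sdot T s t ^ 2) / sdot T s t ^ 2 + eps
  else 1.

Definition coefA (s : R -> R) (t : R) : R := 2 * s t ^ 2.

Definition coefR1 (T : R) (s : R -> R) (t : R) : R :=
  sdot T s t * s t / (1 + sdot T s t ^ 2).

Open Scope C_scope.

Definition zeta (T eps : R) (s : R -> R) (t x : R) : C :=
  Ci / 2 * RtoC ((sigma T eps s t - 1) * sdot T s t * s t * x ^ 2)%R.

Definition coefB (T eps : R) (s : R -> R) (t x : R) : C :=
  RtoC (x * (sdot T s t / s t))%R
  - Ci / RtoC (s t ^ 2)%R * Dx (zeta T eps s) t x.

Definition coefG (T eps : R) (s : R -> R) (gamma : R -> R -> C) (t x : R) : C :=
  Dt T (zeta T eps s) t x
  - RtoC (x * (sdot T s t / s t))%R * Dx (zeta T eps s) t x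
  + Ci * gamma t (x * s t)%R
  + Ci / RtoC (2 * s t ^ 2)%R
    * (Dx (zeta T eps s) t x * Dx (zeta T eps s) t x
       - Dx (Dx (zeta T eps s)) t x).

Definition coefR2 (T eps : R) (s : R -> R) (g : R -> C) (t : R) : C :=
  (g t - Dt T (zeta T eps s) t 1%R) * RtoC (coefR1 T s t)
  + Dx (zeta T eps s) t 1%R.

Definition p0 (T eps : R) (s : R -> R) (w0 : R -> C) (x : R) : C :=
  let w0' := CDerive_on 0 (s 0%R) w0 in
  RtoC (s 0%R) * Cexp (zeta T eps s 0 x)
  * (w0' (x * s 0)%R
     + Dx (zeta T eps s) 0 x * CInt (fun xi => w0' (xi * s 0)%R) 0 x).

Definition theta (p : R -> R -> C) (t x : R) : C := CInt (p t) 0 x.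

(* The regularity required of a solution: p, p_t, p_x and p_xx exist and are
   continuous up to the boundary of [0, T] x [0, 1]. *)
Definition classical_regularity (T : R) (p : R -> R -> C) : Prop :=
  (forall t x, Icc 0 T t -> Icc 0 1 x ->
     ex_derive_on (V := C_R_NormedModule) 0 T (fun tau => p tau x) t /\
     ex_derive_on (V := C_R_NormedModule) 0 1 (p t) x /\
     ex_derive_on (V := C_R_NormedModule) 0 1 (Dx p t) x) /\
  continuous_on (rectangle T) (fun q => p (fst q) (snd q)) /\
  continuous_on (rectangle T) (fun q => Dt T p (fst q) (snd q)) /\
  continuous_on (rectangle T) (fun q => Dx p (fst q) (snd q)) /\
  continuous_on (rectangle T) (fun q => Dx (Dx p) (fst q) (snd q)).

Record is_solution (T eps : R) (s : R -> R) (g : R -> C) (gamma : R -> R -> C)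
    (pinit : R -> C) (p : R -> R -> C) : Prop := {
  sol_regular : classical_regularity T p;
  sol_pde : forall t x, Icc 0 T t -> Icc 0 1 x ->
    Dt T p t x =
      Ci / RtoC (coefA s t) * Dx (Dx p) t x
      + coefB T eps s t x * Dx p t x
      + (Dx (coefB T eps s) t x + coefG T eps s gamma t x) * p t x
      + Dx (coefG T eps s gamma) t x * theta p t x;
  sol_bc_left : forall t, Icc 0 T t -> Dx p t 0 = 0;
  sol_bc_right : forall t, Icc 0 T t ->
    let r1 := RtoC (coefR1 T s t) in
    Ci / RtoC (coefA s t) * Dx p t 1 =
      (1 - r1 * coefB T eps s t 1) / r1 * p t 1%R
      - (r1 * coefG T eps s gamma t 1 + coefR2 T eps s g t) / r1
        * theta p t 1;
  sol_init : forall x, Icc 0 1 x -> p 0%R x = pinit x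
}.

Close Scope C_scope.

(* Main.v *)
Require Import Defs.
From Stdlib Require Import Reals Lra ClassicalEpsilon.
From Coquelicot Require Import Coquelicot.
(* [Dx] is the partial derivative, not its namesake on the real line. *)
Import Defs.

Open Scope R_scope.

(** The result is an energy estimate.  Write [b = sigma s' / s].  The phase
[zeta] is such that [B = x b] is real, and the equation is in divergence form:
[p_t = (i/A p_x + B p + G theta)_x], because [theta_x = p].  Multiplying by the
conjugate of [p] and taking real parts, the term [i/A |p_x|^2] disappears and

  [2 Re (p_t conj p) = F_x + b |p|^2 + 2 Re ((G p + G_x theta) conj p)]

with the flux [F = 2 Re (i/A p_x conj p) + B |p|^2].  The flux vanishes at
[x = 0], since [p_x] and [B] do.  At [x = 1] the boundary condition turns it into

  [F = (2 / R1 - b) |p|^2 - 2 Re (kappa theta conj p)],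
  [kappa = G(t,1) + R2 / R1].

Here the choice of [sigma] enters: [2 / R1 - b] equals [- eps s' / s] when the
profile increases and [(2 + s'^2) / (s' s)] when it decreases, so it is negative
and, by compactness of the time interval, bounded away from zero
([drift_dominates]).  The negative square absorbs the mixed term, which
leaves [F <= N |theta(t,1)|^2] at [x = 1] ([boundary_dissipation]).
Cauchy-Schwarz gives [|theta(t,x)|^2 <= E(t)] for the energy
[E(t) = int_0^1 |p|^2 dx], so that [E' <= K E] with a constant [K] depending on
bounds of the coefficients only, and Gronwall's inequality concludes
([energy_estimate]).

Two points need care because every derivative is one-sided at the end points.
Unknowns are extended to the plane by freezing their arguments at the boundary of
the rectangle; the extensions are continuous, and their derivatives are used in
open intervals only, which is all that the mean value theorem needs, both for
integration by parts in [x] and for Gronwall in [t].  The bounds on the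
coefficients ([coefficients_bounded]) come from explicit formulas for [B], [G]
and [G_x] in terms of functions that are continuous on a compact set: the
profile, its first two derivatives, [g], and [gamma] and [gamma_y] along
[(t, x s(t))]. *)

(** * Calculus of derivatives within an interval *)

Lemma within_Icc_proper (a b x : R) :
  a < b -> Icc a b x -> ProperFilter (within (Icc a b) (locally x)).
Proof.
intros Hab Hx; split; [|apply within_filter, locally_filter].
intros P [d Hd]; unfold Icc in *; pose proof (cond_pos d) as d0.
destruct (Rle_lt_dec b x) as [Hbx|Hbx].
- exists (x - Rmin (d / 2) (x - a)).
  assert (H1 := Rmin_l (d / 2) (x - a)); assert (H2 := Rmin_r (d / 2) (x - a)).
  assert (0 < Rmin (d / 2) (x - a)) by (apply Rmin_pos; lra).
  apply Hd; [|lra].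
  change (Rabs (x - Rmin (d / 2) (x - a) - x) < d); rewrite Rabs_left; lra.
- exists (x + Rmin (d / 2) (b - x)).
  assert (H1 := Rmin_l (d / 2) (b - x)); assert (H2 := Rmin_r (d / 2) (b - x)).
  assert (0 < Rmin (d / 2) (b - x)) by (apply Rmin_pos; lra).
  apply Hd; [|lra].
  change (Rabs (x + Rmin (d / 2) (b - x) - x) < d); rewrite Rabs_right; lra.
Qed.

Lemma is_filter_lim_within {U : UniformSpace} (D : U -> Prop) (x : U) :
  is_filter_lim (within D (locally x)) x.
Proof. apply filter_le_within. Qed.

(** Differentiability along a filter passes to finer filters with the same
    limit point; uniqueness of limits is what pins that point down. *)
Lemma filterdiff_filter_le {U V : NormedModule R_AbsRing}
    (F G : (U -> Prop) -> Prop) (f l : U -> V) (x : U) :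
  ProperFilter F -> is_filter_lim F x -> is_filter_lim G x ->
  filter_le F G -> filterdiff f G l -> filterdiff f F l.
Proof.
intros HF HFx HGx Hle [Hl Hd]; split; [exact Hl|].
intros y Hy; rewrite <- (is_filter_lim_unique x y HFx Hy).
intros e; apply Hle, (Hd x HGx e).
Qed.

(** The chain rule between two sets: the inner map has to send one set into the
    other. *)
Lemma filterdiff_comp_within {U V W : NormedModule R_AbsRing}
    (D : U -> Prop) (E : V -> Prop) (f : U -> V) (g : V -> W)
    (lf : U -> V) (lg : V -> W) (x : U) :
  ProperFilter (within D (locally x)) ->
  (forall y, D y -> E (f y)) ->
  filterdiff f (within D (locally x)) lf ->
  filterdiff g (within E (locally (f x))) lg ->
  filterdiff (fun y => g (f y)) (within D (locally x)) (fun y => lg (lf y)).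
Proof.
intros HF HDE Hf Hg.
assert (Hc : filterlim f (within D (locally x)) (locally (f x))).
{ apply filterdiff_continuous_aux; [exists lf; exact Hf|].
  apply is_filter_lim_within. }
apply filterdiff_comp; [exact Hf|].
apply (filterdiff_filter_le _ (within E (locally (f x)))) with (x := f x).
- apply filtermap_proper_filter, HF.
- exact Hc.
- apply is_filter_lim_within.
- intros P HP; specialize (Hc _ HP); unfold filtermap, within in *.
  revert Hc; apply filter_imp; intros y Hy Dy; exact (Hy Dy (HDE y Dy)).
- exact Hg.
Qed.

Lemma is_derive_on_ext {V : NormedModule R_AbsRing} (a b : R)
    (f g : R -> V) (x : R) (l : V) :
  a < b -> Icc a b x ->
  (forall y, Icc a b y -> f y = g y) -> is_derive_on a b f x l ->
  is_derive_on a b g x l.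
Proof.
intros Hab Hx E; apply filterdiff_ext_loc.
- unfold within; apply filter_forall; exact E.
- intros y Hy; rewrite <- (is_filter_lim_unique
    (FF := Proper_StrongProper _ (within_Icc_proper a b x Hab Hx)) x y
    (is_filter_lim_within _ _) Hy).
  exact (E x Hx).
Qed.

Lemma is_derive_on_is_derive {V : NormedModule R_AbsRing} (a b : R)
    (f : R -> V) (x : R) (l : V) :
  a < b -> Icc a b x -> is_derive f x l -> is_derive_on a b f x l.
Proof.
intros Hab Hx Hf.
assert (HF := within_Icc_proper a b x Hab Hx).
apply filterdiff_locally with x; [apply is_filter_lim_within|exact Hf].
Qed.

(** This is how one-sided derivatives become ordinary ones: at an interior point
    the interval is a neighbourhood. *)
Lemma is_derive_on_interior {V : NormedModule R_AbsRing} (a b : R)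
    (f : R -> V) (x : R) (l : V) :
  a < x < b -> is_derive_on a b f x l -> is_derive f x l.
Proof.
intros Hx [Hl Hf]; split; [exact Hl|]; intros y Hy e.
specialize (Hf x (is_filter_lim_within _ _) e).
rewrite <- (is_filter_lim_locally_unique (V := R_NormedModule) _ _ Hy).
assert (Hi : locally x (Icc a b)).
{ assert (H1 := open_and _ _ (open_gt a) (open_lt b) x (conj (proj1 Hx) (proj2 Hx))).
  revert H1; apply filter_imp; unfold Icc; intros z Hz; simpl in Hz; lra. }
revert Hf Hi; unfold within.
intros H1 H2; generalize (filter_and _ _ H1 H2).
apply filter_imp; intros z [K1 K2]; exact (K1 K2).
Qed.

Lemma is_derive_on_continuous {V : NormedModule R_AbsRing} (a b : R)
    (f : R -> V) (x : R) (l : V) :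
  is_derive_on a b f x l ->
  filterlim f (within (Icc a b) (locally x)) (locally (f x)).
Proof.
intros Hf; apply filterdiff_continuous_aux;
  [eexists; exact Hf|apply is_filter_lim_within].
Qed.

Lemma is_derive_on_linear {V W : NormedModule R_AbsRing} (a b : R)
    (L : V -> W) (f : R -> V) (x : R) (l : V) :
  is_linear L -> is_derive_on a b f x l ->
  is_derive_on a b (fun y => L (f y)) x (L l).
Proof.
intros HL Hf.
assert (H := filterdiff_comp f L _ L Hf (filterdiff_linear L HL)).
unfold is_derive_on; apply (filterdiff_ext_lin _ _ _ H); cbv beta.
intros h; apply (linear_scal L HL).
Qed.

Lemma is_derive_on_comp (a b : R) (phi f : R -> R) (x l l' : R) :
  a < b -> Icc a b x ->
  is_derive_on (V := R_NormedModule) a b f x l -> is_derive phi (f x) l' ->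
  is_derive_on (V := R_NormedModule) a b (fun y => phi (f y)) x (l * l').
Proof.
intros Hab Hx Hf Hphi.
assert (HF := within_Icc_proper a b x Hab Hx).
assert (Hc := is_derive_on_continuous a b f x l Hf).
assert (HG := filtermap_proper_filter _ _ f _ HF).
assert (H := filterdiff_comp f phi _ _ Hf
  (filterdiff_locally (V := R_NormedModule) phi (f x) _ Hc Hphi)).
apply (filterdiff_ext_lin _ _ _ H); intros h.
unfold scal; simpl; unfold mult; simpl; ring.
Qed.

Lemma is_derive_on_mult (a b : R) (f g : R -> R) (x l l' : R) :
  a < b -> Icc a b x ->
  is_derive_on (V := R_NormedModule) a b f x l ->
  is_derive_on (V := R_NormedModule) a b g x l' ->
  is_derive_on (V := R_NormedModule) a b (fun y => f y * g y) x
    (l * g x + f x * l').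
Proof.
intros Hab Hx Hf Hg.
assert (HF := within_Icc_proper a b x Hab Hx).
assert (Hcf := is_derive_on_continuous a b f x l Hf).
assert (Hcg := is_derive_on_continuous a b g x l' Hg).
assert (HG := filtermap_proper_filter _ _ (fun t => (f t, g t)) _ HF).
assert (Hlim : is_filter_lim (T := prod_UniformSpace R_UniformSpace R_UniformSpace)
  (filtermap (fun t => (f t, g t)) (within (Icc a b) (locally x))) (f x, g x)).
{ intros P [d Hd]; unfold filtermap.
  assert (H1 := Hcf _ (locally_ball (f x) d)).
  assert (H2 := Hcg _ (locally_ball (g x) d)).
  unfold filtermap in H1, H2.
  generalize (filter_and _ _ H1 H2); apply filter_imp.
  intros y [K1 K2]; apply Hd; split; assumption. }
assert (H := filterdiff_comp_2 (U := R_NormedModule) (V := R_NormedModule)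
  (W := R_NormedModule) f g Rmult _ _
  (fun u v : R => u * g x + f x * v) Hf Hg
  (@filterdiff_mult R_AbsRing _ HG (f x, g x) Hlim Rmult_comm)).
apply (filterdiff_ext_lin _ _ _ H); intros h.
unfold scal, plus; simpl; unfold mult; simpl; ring.
Qed.

Lemma is_derive_on_pair (a b : R) (f g : R -> R) (x l l' : R) :
  is_derive_on (V := R_NormedModule) a b f x l ->
  is_derive_on (V := R_NormedModule) a b g x l' ->
  is_derive_on (V := C_R_NormedModule) a b (fun y => (f y, g y)) x (l, l').
Proof.
intros Hf Hg.
assert (H := filterdiff_comp_2 (U := R_NormedModule) (V := R_NormedModule)
  (W := C_R_NormedModule) f g (fun u v : R => (u, v)) _ _
  (fun u v : R => (u, v)) Hf Hg
  (filterdiff_ext _ _ _ (fun y => surjective_pairing y)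
     (filterdiff_ext_lin _ _ _ (filterdiff_id _)
        (fun y => surjective_pairing y)))).
exact H.
Qed.

Lemma is_derive_on_const {V : NormedModule R_AbsRing} (a b x : R) (c : V) :
  is_derive_on a b (fun _ => c) x zero.
Proof.
apply (filterdiff_ext_lin _ _ _ (filterdiff_const c)).
intros h; symmetry; apply (scal_zero_r (V := V)).
Qed.

Lemma is_derive_on_plus {V : NormedModule R_AbsRing} (a b : R) (f g : R -> V)
    (x : R) (l l' : V) :
  is_derive_on a b f x l -> is_derive_on a b g x l' ->
  is_derive_on a b (fun y => plus (f y) (g y)) x (plus l l').
Proof.
intros Hf Hg; apply (filterdiff_ext_lin _ _ _ (filterdiff_plus_fct _ _ _ _ Hf Hg)).
intros h; symmetry; apply (scal_distr_l (V := V)).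
Qed.

Lemma is_linear_Cmult (z : C) :
  is_linear (U := C_R_NormedModule) (V := C_R_NormedModule) (Cmult z).
Proof.
split.
- intros x y; exact (Cmult_plus_distr_l z x y).
- intros k x; apply injective_projections; unfold scal; simpl; unfold scal;
    simpl; unfold mult; simpl; ring.
- exists (Cmod z + 1); split; [assert (H := Cmod_ge_0 z); lra|].
  intros x.
  assert (H : Cmod (Cmult z x) <= (Cmod z + 1) * Cmod x).
  { rewrite Cmod_mult; apply Rmult_le_compat_r; [apply Cmod_ge_0|lra]. }
  rewrite (Cmod_norm (Cmult z x)), (Cmod_norm x) in H; exact H.
Qed.

Lemma is_derive_on_CRmult (a b : R) (z : C) (f : R -> R) (x l : R) :
  a < b -> Icc a b x -> is_derive_on (V := R_NormedModule) a b f x l ->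
  is_derive_on (V := C_R_NormedModule) a b (fun y => z * RtoC (f y))%C x
    (z * RtoC l)%C.
Proof.
intros Hab Hx Hf.
apply (is_derive_on_linear (V := C_R_NormedModule) (W := C_R_NormedModule) a b
  (Cmult z) (fun y => RtoC (f y)) x (RtoC l) (is_linear_Cmult z)).
apply is_derive_on_pair; [exact Hf|].
apply (is_derive_on_const (V := R_NormedModule)).
Qed.

Lemma is_derive_on_Re_Im (a b : R) (f : R -> C) (x : R) (l : C) :
  is_derive_on (V := C_R_NormedModule) a b f x l ->
  is_derive_on (V := R_NormedModule) a b (fun y => Re (f y)) x (Re l) /\
  is_derive_on (V := R_NormedModule) a b (fun y => Im (f y)) x (Im l).
Proof.
intros Hf; split.
- exact (is_derive_on_linear (V := C_R_NormedModule) (W := R_NormedModule) a b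
    Re f x l (is_linear_fst (U := R_NormedModule) (V := R_NormedModule)) Hf).
- exact (is_derive_on_linear (V := C_R_NormedModule) (W := R_NormedModule) a b
    Im f x l (is_linear_snd (U := R_NormedModule) (V := R_NormedModule)) Hf).
Qed.

Lemma Derive_on_correct {V : CompleteNormedModule R_AbsRing} (a b : R)
    (f : R -> V) (x : R) :
  a < b -> Icc a b x -> ex_derive_on a b f x ->
  is_derive_on a b f x (Derive_on a b f x).
Proof.
intros Hab Hx [l Hl]; rewrite (is_derive_on_unique a b f x l Hab Hx Hl); exact Hl.
Qed.

(** * Continuous functions on a rectangle *)

(** Compactness in the form of a Lebesgue number: the local radius at [q] is
    taken below [1 / (1 + norm (f q))], so a uniform lower bound [d] on the radii
    that are used bounds [f] at the centres by [1 / d], hence everywhere by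
    [1 + 1 / d]. *)
Lemma continuous_on_rectangle_bounded {V : NormedModule R_AbsRing} (T : R)
    (f : R * R -> V) :
  continuous_on (rectangle T) f ->
  exists M, forall q, rectangle T q -> norm (f q) <= M.
Proof.
intros Hf.
assert (Hloc : forall u v, exists d : posreal, rectangle T (u, v) ->
  d * norm (f (u, v)) <= 1 /\
  forall q, rectangle T q -> Rabs (fst q - u) < d -> Rabs (snd q - v) < d ->
    norm (minus (f q) (f (u, v))) < 1).
{ intros u v; destruct (excluded_middle_informative (rectangle T (u, v)))
    as [Hq|Hq]; [|exists (mkposreal 1 Rlt_0_1); contradiction].
  destruct (Hf _ Hq _ (locally_ball_norm (f (u, v)) (mkposreal 1 Rlt_0_1)))
    as [d Hd].
  assert (Hn := norm_ge_0 (f (u, v))).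
  assert (Hm : 0 < Rmin d (/ (1 + norm (f (u, v))))).
  { apply Rmin_pos; [apply cond_pos|apply Rinv_0_lt_compat; lra]. }
  exists (mkposreal _ Hm); intros _; simpl; split.
  - apply Rle_trans with (/ (1 + norm (f (u, v))) * norm (f (u, v))).
    + apply Rmult_le_compat_r; [exact Hn|apply Rmin_r].
    + apply (Rmult_le_reg_l (1 + norm (f (u, v)))); [lra|].
      rewrite <- Rmult_assoc, Rinv_r; lra.
  - assert (Hl := Rmin_l d (/ (1 + norm (f (u, v))))).
    intros q Hr H1 H2; apply Hd; [|exact Hr].
    split; [change (Rabs (fst q - u) < d)|change (Rabs (snd q - v) < d)]; lra. }
pose (delta u v := proj1_sig (constructive_indefinite_description _ (Hloc u v))).
destruct (compactness_value_2d 0 T 0 1 delta) as [d Hd].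
exists (1 + / d); intros [x y] [Hx Hy]; simpl in Hx, Hy.
apply Rnot_lt_le; intros Hlt; apply (Hd x y Hx Hy).
intros (u & v & Hu & Hv & H1 & H2 & H3); revert H1 H2 H3; unfold delta.
destruct (constructive_indefinite_description _ (Hloc u v)) as [e He]; simpl.
intros H1 H2 H3; destruct (He (conj Hu Hv)) as [K1 K2].
specialize (K2 (x, y) (conj Hx Hy) H1 H2).
assert (K3 := norm_triangle (minus (f (x, y)) (f (u, v))) (f (u, v))).
assert (E : forall p q : V, plus (minus p q) q = p).
{ intros p q; unfold minus; rewrite <- plus_assoc, (plus_opp_l (G := V)).
  apply (plus_zero_r (G := V)). }
rewrite E in K3.
assert (d0 := cond_pos d).
assert (K4 : norm (f (u, v)) <= / d).
{ apply (Rmult_le_reg_l d); [exact d0|]; rewrite Rinv_r by lra.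
  apply Rle_trans with (2 := K1); apply Rmult_le_compat_r;
    [apply norm_ge_0|exact H3]. }
lra.
Qed.

(** The projection of the line onto [[a, b]]. *)
Definition clamp (a b x : R) : R := Rmax a (Rmin b x).

Lemma clamp_Icc (a b x : R) : a <= b -> Icc a b (clamp a b x).
Proof.
intros H; unfold Icc, clamp; split; [apply Rmax_l|].
apply Rmax_lub; [exact H|apply Rmin_l].
Qed.

Lemma clamp_id (a b x : R) : Icc a b x -> clamp a b x = x.
Proof.
intros [H1 H2]; unfold clamp.
rewrite Rmin_right, Rmax_right by lra; reflexivity.
Qed.

Lemma clamp_lipschitz (a b x y : R) :
  Rabs (clamp a b x - clamp a b y) <= Rabs (x - y).
Proof.
unfold clamp, Rmax, Rmin; destruct (Rle_dec b x), (Rle_dec b y);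
  repeat destruct (Rle_dec _ _); unfold Rabs; repeat destruct (Rcase_abs _); lra.
Qed.

Lemma locally_clamp (a b x : R) :
  a < x < b -> locally x (fun y => clamp a b y = y).
Proof.
intros Hx.
assert (H1 := open_and _ _ (open_gt a) (open_lt b) x Hx).
revert H1; apply filter_imp; intros z Hz; simpl in Hz.
apply clamp_id; unfold Icc; lra.
Qed.

Lemma is_derive_clamp (a b : R) (f : R -> R) (x l : R) :
  a < x < b -> is_derive f x l -> is_derive (fun y => f (clamp a b y)) x l.
Proof.
intros Hx; apply is_derive_ext_loc.
generalize (locally_clamp a b x Hx); apply filter_imp.
intros y ->; reflexivity.
Qed.

(** Freezing both arguments outside the rectangle turns continuity up to the
    boundary into continuity on the whole plane. *)
Lemma continuity_2d_clamp (T : R) (f : R * R -> R) (t x : R) :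
  0 <= T -> continuous_on (U := R_UniformSpace) (rectangle T) f ->
  continuity_2d_pt (fun t x => f (clamp 0 T t, clamp 0 1 x)) t x.
Proof.
intros HT Hf.
assert (Hin : forall t x, rectangle T (clamp 0 T t, clamp 0 1 x))
  by (intros; split; apply clamp_Icc; simpl; lra).
intros e; destruct (Hf _ (Hin t x) _ (locally_ball (f (clamp 0 T t, clamp 0 1 x)) e))
  as [d Hd].
exists d; intros t' x' Ht Hx; apply (Hd (clamp 0 T t', clamp 0 1 x')); [|apply Hin].
split; (eapply Rle_lt_trans; [apply clamp_lipschitz|assumption]).
Qed.

Lemma continuous_on_Re (D : R * R -> Prop) (f : R * R -> C) :
  continuous_on D f -> continuous_on (U := R_UniformSpace) D (fun q => Re (f q)).
Proof.
intros Hf q Hq; eapply filterlim_comp; [exact (Hf q Hq)|].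
intros P [d Hd]; exists d; intros z Hz; apply Hd, Hz.
Qed.

Lemma continuous_on_Im (D : R * R -> Prop) (f : R * R -> C) :
  continuous_on D f -> continuous_on (U := R_UniformSpace) D (fun q => Im (f q)).
Proof.
intros Hf q Hq; eapply filterlim_comp; [exact (Hf q Hq)|].
intros P [d Hd]; exists d; intros z Hz; apply Hd, Hz.
Qed.

Lemma continuity_2d_slice (f : R -> R -> R) (t x : R) :
  continuity_2d_pt f t x -> continuous (f t) x.
Proof.
intros Hf; apply filterlim_locally; intros e; destruct (Hf e) as [d Hd].
exists d; intros y Hy; apply Hd; [|exact Hy].
rewrite Rminus_diag_eq, Rabs_R0; [apply cond_pos|reflexivity].
Qed.

Lemma is_derive_Re_Im_clamp (a b : R) (f : R -> C) (x : R) :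
  a < x < b -> ex_derive_on (V := C_R_NormedModule) a b f x ->
  is_derive (fun y => Re (f (clamp a b y))) x (Re (CDerive_on a b f x)) /\
  is_derive (fun y => Im (f (clamp a b y))) x (Im (CDerive_on a b f x)).
Proof.
intros Hx Hf.
assert (Hf' : is_derive_on (V := C_R_NormedModule) a b f x (CDerive_on a b f x)).
{ apply (Derive_on_correct (V := C_R_CompleteNormedModule));
    [lra|unfold Icc; lra|exact Hf]. }
destruct (is_derive_on_Re_Im a b f x _ Hf') as [H1 H2].
split; [apply (is_derive_clamp a b (fun y => Re (f y)))
       |apply (is_derive_clamp a b (fun y => Im (f y)))]; try exact Hx;
  apply (is_derive_on_interior a b); assumption.
Qed.

Lemma continuous_sqr (f : R -> R) (x : R) :
  continuous f x -> continuous (fun x => f x ^ 2) x.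
Proof.
intros Hf; apply (continuous_comp f (fun y => y ^ 2)); [exact Hf|].
apply (ex_derive_continuous (V := R_NormedModule)); auto_derive; exact I.
Qed.

Lemma continuous_Rplus (f g : R -> R) (x : R) :
  continuous f x -> continuous g x -> continuous (fun y => f y + g y) x.
Proof. exact (continuous_plus (V := R_NormedModule) f g x). Qed.

Lemma continuous_Rminus (f g : R -> R) (x : R) :
  continuous f x -> continuous g x -> continuous (fun y => f y - g y) x.
Proof. exact (continuous_minus (V := R_NormedModule) f g x). Qed.

Lemma continuous_Rmult (f g : R -> R) (x : R) :
  continuous f x -> continuous g x -> continuous (fun y => f y * g y) x.
Proof. exact (continuous_mult (K := R_AbsRing) f g x). Qed.

(** * Integrals and their derivatives *)

Lemma ex_RInt_everywhere_continuous (f : R -> R) (a b : R) :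
  (forall x, continuous f x) -> ex_RInt f a b.
Proof.
intros Hf; apply (ex_RInt_continuous (V := R_CompleteNormedModule)).
intros x _; apply Hf.
Qed.

Lemma ex_RInt_slice (f : R -> R -> R) (t a b : R) :
  (forall t x, continuity_2d_pt f t x) -> ex_RInt (f t) a b.
Proof.
intros Hf; apply (ex_RInt_continuous (V := R_CompleteNormedModule)).
intros x _; apply continuity_2d_slice, Hf.
Qed.

(** Uniform continuity on a strip around [t] makes the integrands converge
    uniformly. *)
Lemma continuous_RInt_slice (f : R -> R -> R) (t : R) :
  (forall t x, continuity_2d_pt f t x) ->
  continuous (fun t => RInt (f t) 0 1) t.
Proof.
intros Hf; apply filterlim_locally; intros e.
destruct (uniform_continuity_2d f (t - 1) (t + 1) 0 1
  (fun x y _ _ => Hf x y) (pos_div_2 e)) as [d Hd].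
assert (Hm : 0 < Rmin d 1) by (apply Rmin_pos; [apply cond_pos|lra]).
exists (mkposreal _ Hm); intros y Hy.
assert (Hy' : Rabs (y - t) < Rmin d 1) by exact Hy; clear Hy.
assert (H1 := Rmin_l d 1); assert (H2 := Rmin_r d 1).
destruct (Rabs_def2 _ _ Hy') as [H3 H4].
change (Rabs (RInt (f y) 0 1 - RInt (f t) 0 1) < e).
rewrite <- (RInt_minus (V := R_CompleteNormedModule)) by (apply ex_RInt_slice, Hf).
apply Rle_lt_trans with ((1 - 0) * (e / 2)); [|assert (e0 := cond_pos e); lra].
apply (abs_RInt_le_const _ 0 1 (e / 2)); [lra| |].
- apply (ex_RInt_minus (V := R_NormedModule)); apply ex_RInt_slice, Hf.
- intros x Hx; apply Rlt_le, (Hd t x y x); try lra.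
  rewrite Rminus_diag_eq, Rabs_R0; [apply cond_pos|reflexivity].
Qed.

Lemma is_derive_RInt_slice (f f' : R -> R -> R) (a b t : R) :
  a < t < b ->
  (forall t x, continuity_2d_pt f t x) ->
  (forall t x, continuity_2d_pt f' t x) ->
  (forall t x, a < t < b -> is_derive (fun tau => f tau x) t (f' t x)) ->
  is_derive (fun t => RInt (f t) 0 1) t (RInt (f' t) 0 1).
Proof.
intros Ht Hf Hf' Hd.
assert (Hloc : locally t (fun tau => a < tau < b))
  by exact (open_and _ _ (open_gt a) (open_lt b) t Ht).
replace (RInt (f' t) 0 1) with (RInt (fun x => Derive (fun u => f u x) t) 0 1).
- apply is_derive_RInt_param.
  + revert Hloc; apply filter_imp; intros tau Htau x _.
    exists (f' tau x); apply Hd, Htau.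
  + intros x _; apply continuity_2d_pt_ext_loc with f'; [|apply Hf'].
    destruct Hloc as [d Hloc]; exists d; intros tau y Htau _.
    symmetry; apply is_derive_unique, Hd, Hloc, Htau.
  + apply filter_forall; intros tau; apply ex_RInt_slice, Hf.
- apply RInt_ext; intros x _; apply is_derive_unique, Hd, Ht.
Qed.

(** The fundamental theorem of calculus without derivatives at the end points:
    the mean value theorem, applied to the difference of [f] and the integral,
    asks for them in the open interval only. *)
Lemma RInt_interior_derivative (f f' : R -> R) (a b : R) :
  a < b -> (forall x, continuous f x) -> (forall x, continuous f' x) ->
  (forall x, a < x < b -> is_derive f x (f' x)) ->
  RInt f' a b = f b - f a.
Proof.
intros Hab Hf Hf' Hd.
assert (HI : forall x, is_derive (RInt f' a) x (f' x)).
{ intros x; apply (is_derive_RInt (V := R_NormedModule) f' (RInt f' a) a x); [|apply Hf'].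
  apply filter_forall; intros y; apply (RInt_correct (V := R_CompleteNormedModule)).
  apply (ex_RInt_continuous (V := R_CompleteNormedModule)); intros z _; apply Hf'. }
destruct (MVT_gen (fun x => f x - RInt f' a x) a b (fun _ => 0)) as (c & _ & Hc).
- rewrite Rmin_left, Rmax_right by lra; intros x Hx.
  replace 0 with (f' x - f' x) by ring.
  apply (is_derive_minus (V := R_NormedModule)); [apply Hd, Hx|apply HI].
- intros x _; apply continuity_pt_filterlim.
  apply (continuous_minus (V := R_NormedModule)); [apply Hf|].
  apply (ex_derive_continuous (V := R_NormedModule)); exists (f' x); apply HI.
- rewrite (RInt_point (V := R_CompleteNormedModule)) in Hc.
  unfold zero in Hc; simpl in Hc; lra.
Qed.

(** The derivative is required in the open interval only, so that one-sided
    derivatives at the end points never enter. *)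
Lemma gronwall (E E' : R -> R) (K T : R) :
  (forall t, continuous E t) ->
  (forall t, 0 < t < T -> is_derive E t (E' t)) ->
  (forall t, 0 < t < T -> E' t <= K * E t) ->
  forall t, Icc 0 T t -> E t <= exp (K * t) * E 0.
Proof.
intros Hc Hd Hle t [Ht0 HtT].
destruct (Req_dec t 0) as [->|Hne]; [rewrite Rmult_0_r, exp_0; lra|].
assert (Hq : E t * exp (- (K * t)) <= E 0).
{ (* The intermediate point may be an end point, hence the default slope 0. *)
  destruct (MVT_gen (fun t => E t * exp (- (K * t))) 0 t
    (fun t => if Rlt_dec 0 t then if Rlt_dec t T then
       (E' t - K * E t) * exp (- (K * t)) else 0 else 0)) as (c & Hcc & Hm).
  - rewrite Rmin_left, Rmax_right by lra; intros x Hx.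
    destruct (Rlt_dec 0 x), (Rlt_dec x T); try lra.
    replace ((E' x - K * E x) * exp (- (K * x))) with
      (E' x * exp (- (K * x)) + E x * (- K * exp (- (K * x)))) by ring.
    apply (is_derive_mult (K := R_AbsRing) E (fun t => exp (- (K * t))) x);
      [apply Hd; lra| |exact Rmult_comm].
    auto_derive; [exact I|ring].
  - intros x _; apply continuity_pt_filterlim.
    apply (continuous_mult (K := R_AbsRing) E (fun t => exp (- (K * t)))); [apply Hc|].
    apply (ex_derive_continuous (V := R_NormedModule)); auto_derive; exact I.
  - rewrite Rmult_0_r, Ropp_0, exp_0 in Hm.
    assert (Hs : (if Rlt_dec 0 c then if Rlt_dec c T then
       (E' c - K * E c) * exp (- (K * c)) else 0 else 0) <= 0).
    { destruct (Rlt_dec 0 c), (Rlt_dec c T); try lra.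
      assert (H1 := Hle c (conj r r0)); assert (H2 := exp_pos (- (K * c))); nra. }
    nra. }
replace (E t) with (exp (K * t) * (E t * exp (- (K * t)))).
- apply Rmult_le_compat_l; [apply Rlt_le, exp_pos|exact Hq].
- rewrite exp_Ropp; field; apply Rgt_not_eq, exp_pos.
Qed.

(** * The energy estimate *)

(** Cauchy-Schwarz against the constant 1: with [m] the integral on the left,
    integrate [2 m f - m ^ 2 <= f ^ 2]. *)
Lemma sqr_RInt_le (f : R -> R) (x : R) :
  Icc 0 1 x -> (forall x, continuous f x) ->
  RInt f 0 x ^ 2 <= RInt (fun y => f y ^ 2) 0 1.
Proof.
intros [Hx0 Hx1] Hf.
assert (Hf2 : forall x, continuous (fun y => f y ^ 2) x)
  by (intros; apply continuous_sqr, Hf).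
set (m := RInt f 0 x).
apply Rle_trans with (RInt (fun y => f y ^ 2) 0 x).
- assert (H : is_RInt (fun y => 2 * m * f y - m ^ 2) 0 x
      (2 * m * m - (x - 0) * m ^ 2)).
  { apply (is_RInt_minus (V := R_NormedModule)).
    - apply (is_RInt_scal (V := R_NormedModule)), (RInt_correct (V := R_CompleteNormedModule)).
      apply ex_RInt_everywhere_continuous, Hf.
    - apply (is_RInt_const (V := R_NormedModule)). }
  apply Rle_trans with (RInt (fun y => 2 * m * f y - m ^ 2) 0 x).
  + rewrite (is_RInt_unique _ _ _ _ H); assert (H1 := pow2_ge_0 m); nra.
  + apply RInt_le; [exact Hx0|eexists; exact H| |].
    * apply ex_RInt_everywhere_continuous, Hf2.
    * intros y _; assert (H1 := pow2_ge_0 (f y - m)); nra.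
- rewrite <- (RInt_Chasles (V := R_CompleteNormedModule) _ 0 x 1)
    by (apply ex_RInt_everywhere_continuous, Hf2).
  assert (H : 0 <= RInt (fun y => f y ^ 2) x 1).
  { apply RInt_ge_0; [exact Hx1|apply ex_RInt_everywhere_continuous, Hf2|].
    intros y _; apply pow2_ge_0. }
  unfold plus; simpl plus; simpl in *; lra.
Qed.

Lemma Cmod_CInt_le (f : R -> C) (u v : R -> R) (x : R) :
  Icc 0 1 x -> (forall x, continuous u x) -> (forall x, continuous v x) ->
  (forall y, Icc 0 1 y -> f y = (u y, v y)) ->
  Cmod (CInt f 0 x) ^ 2 <= RInt (fun y => u y ^ 2 + v y ^ 2) 0 1.
Proof.
intros Hx Hu Hv Hf.
assert (E : CInt f 0 x = (RInt u 0 x, RInt v 0 x)).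
{ apply is_RInt_unique.
  apply (is_RInt_ext (V := C_R_NormedModule) (fun y => (u y, v y))).
  - intros y; rewrite Rmin_left, Rmax_right by apply Hx; intros Hy.
    symmetry; apply Hf; unfold Icc in *; lra.
  - apply (is_RInt_fct_extend_pair (U := R_NormedModule) (V := R_NormedModule));
      apply (RInt_correct (V := R_CompleteNormedModule)), ex_RInt_everywhere_continuous;
      assumption. }
rewrite E, Cmod2_alt; simpl Re; simpl Im.
rewrite (RInt_plus (V := R_CompleteNormedModule)) by
  (apply ex_RInt_everywhere_continuous; intros; apply continuous_sqr; auto).
apply Rplus_le_compat; apply sqr_RInt_le; assumption.
Qed.

Lemma Re_mult_conj_le (a c : C) : Re (a * Cconj c) <= Cmod a * Cmod c.
Proof.
apply Rle_trans with (1 := Rle_abs _), Rle_trans with (1 := re_le_Cmod _).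
rewrite Cmod_mult, Cmod_conj; apply Rle_refl.
Qed.

(** The terms of [2 Re (p_t conj p)] that remain once the flux derivative is
    taken out; [z] stands for [p] and [w] for [theta]. *)
Lemma lower_order_le (M : R) (b : R) (G H z w : C) :
  Rabs b <= M -> Cmod G <= M -> Cmod H <= M ->
  b * Cmod z ^ 2 + 2 * Re ((G * z + H * w) * Cconj z)
  <= 4 * M * Cmod z ^ 2 + M * Cmod w ^ 2.
Proof.
intros Hb HG HH.
assert (H1 := Re_mult_conj_le (G * z + H * w) z).
assert (H2 := Cmod_triangle (G * z) (H * w)); rewrite !Cmod_mult in H2.
assert (Hz := Cmod_ge_0 z); assert (Hw := Cmod_ge_0 w).
assert (H3 : Cmod G * Cmod z <= M * Cmod z) by (apply Rmult_le_compat_r; lra).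
assert (H4 : Cmod H * Cmod w <= M * Cmod w) by (apply Rmult_le_compat_r; lra).
assert (H5 : Cmod (G * z + H * w) * Cmod z <= (M * Cmod z + M * Cmod w) * Cmod z)
  by (apply Rmult_le_compat_r; lra).
assert (H6 : b * Cmod z ^ 2 <= M * Cmod z ^ 2).
{ apply Rmult_le_compat_r; [apply pow2_ge_0|].
  apply Rle_trans with (2 := Hb), Rle_abs. }
assert (HM : 0 <= M) by (apply Rle_trans with (2 := HG), Cmod_ge_0).
assert (H7 : 0 <= M * (Cmod z - Cmod w) ^ 2)
  by (apply Rmult_le_pos; [exact HM|apply pow2_ge_0]).
nra.
Qed.

(** Matching on the syntactic shape keeps unification from unfolding the
    operations on the reals. *)
Ltac continuous_R :=
  match goal with
  | |- continuous (fun y => @?f y - @?g y) _ =>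
      apply (continuous_Rminus f g); continuous_R
  | |- continuous (fun y => @?f y + @?g y) _ =>
      apply (continuous_Rplus f g); continuous_R
  | |- continuous (fun y => @?f y * @?g y) _ =>
      apply (continuous_Rmult f g); continuous_R
  | |- continuous (fun y => @?f y ^ 2) _ => apply (continuous_sqr f); continuous_R
  | _ => first [assumption|apply continuous_const]
  end.

(** The shape of the energy flux in real and imaginary parts: [f], [h] stand for
    those of [p_x], [k], [g] for those of [p], and [m] for [x]. *)
Lemma continuous_flux (A B : R) (f g h k m : R -> R) (x : R) :
  continuous f x -> continuous g x -> continuous h x -> continuous k x ->
  continuous m x ->
  continuous (fun y => A * (f y * g y - h y * k y)
                       + B * m y * (k y ^ 2 + g y ^ 2)) x.
Proof. intros; continuous_R. Qed.

Lemma continuous_flux_derivative (A B D : R) (f g h k m l n : R -> R) (x : R) :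
  continuous f x -> continuous g x -> continuous h x -> continuous k x ->
  continuous m x -> continuous l x -> continuous n x ->
  continuous (fun y => A * (f y * g y - h y * k y) + B * (k y ^ 2 + g y ^ 2)
                       + D * m y * (k y * l y + g y * n y)) x.
Proof. intros; continuous_R. Qed.

Definition energy (p : R -> R -> C) (t : R) : R :=
  RInt (fun x => Cmod (p t x) ^ 2) 0 1.

Lemma energy_ge_0 (T : R) (p : R -> R -> C) (t : R) :
  Icc 0 T t -> continuous_on (rectangle T) (fun q => p (fst q) (snd q)) ->
  0 <= energy p t.
Proof.
intros Ht Hp; assert (HT : 0 <= T) by (unfold Icc in Ht; lra).
apply RInt_ge_0; [lra| |intros; apply pow2_ge_0].
apply (ex_RInt_ext (V := R_NormedModule)
  (fun x => Re (p (clamp 0 T t) (clamp 0 1 x)) ^ 2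
            + Im (p (clamp 0 T t) (clamp 0 1 x)) ^ 2)).
- rewrite Rmin_left, Rmax_right by lra; intros x Hx.
  rewrite !clamp_id by (unfold Icc in *; lra); symmetry; apply Cmod2_alt.
- apply ex_RInt_everywhere_continuous; intros x.
  apply continuous_Rplus; apply continuous_sqr.
  + apply (continuity_2d_slice
      (fun t x => Re (p (clamp 0 T t) (clamp 0 1 x)))).
    apply (continuity_2d_clamp T (fun q => Re (p (fst q) (snd q)))); [exact HT|].
    apply continuous_on_Re, Hp.
  + apply (continuity_2d_slice
      (fun t x => Im (p (clamp 0 T t) (clamp 0 1 x)))).
    apply (continuity_2d_clamp T (fun q => Im (p (fst q) (snd q)))); [exact HT|].
    apply continuous_on_Im, Hp.
Qed.

(** The energy method for an equation whose coefficients enter through bounds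
    only.  In the hypothesis on the boundary, [z] stands for [p(t,1)] and [w] for
    [theta(t,1)]; its left-hand side is the flux there, as the condition at
    [x = 1] expresses it. *)
Lemma energy_estimate (T M N : R) (alpha b q : R -> R) (kappa : R -> C)
    (G H : R -> R -> C) (p : R -> R -> C) :
  0 < T ->
  (forall t, Icc 0 T t -> Rabs (b t) <= M) ->
  (forall t x, Icc 0 T t -> Icc 0 1 x ->
     Cmod (G t x) <= M /\ Cmod (H t x) <= M) ->
  (forall t z w, Icc 0 T t ->
     (2 * q t - b t) * Cmod z ^ 2 - 2 * Re (kappa t * w * Cconj z)
     <= N * Cmod w ^ 2) -> 0 <= N ->
  classical_regularity T p ->
  (forall t x, Icc 0 T t -> Icc 0 1 x ->
     Dt T p t x =
       (Ci * RtoC (alpha t) * Dx (Dx p) t x + RtoC (x * b t) * Dx p t x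
        + (RtoC (b t) + G t x) * p t x + H t x * theta p t x)%C) ->
  (forall t, Icc 0 T t -> Dx p t 0 = RtoC 0) ->
  (forall t, Icc 0 T t ->
     (Ci * RtoC (alpha t) * Dx p t 1 =
      RtoC (q t - b t) * p t 1%R - kappa t * theta p t 1)%C) ->
  forall t, Icc 0 T t -> energy p t <= exp ((5 * M + N) * t) * energy p 0.
Proof.
intros HT Hb HGH Hbd HN (Hex & Hp & Hpt & Hpx & Hpxx) Hpde Hl Hr.
(* From here on, every function is replaced by its extension [cl]; [W] is the
   energy density and [W'] its time derivative. *)
pose (cl := fun f : R -> R -> C => fun t x : R => f (clamp 0 T t) (clamp 0 1 x)).
assert (cl_id : forall f t x, Icc 0 T t -> Icc 0 1 x -> cl f t x = f t x).
{ intros f t x Ht Hx; unfold cl; rewrite !clamp_id by assumption; reflexivity. }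
assert (clc : forall f : R -> R -> C,
  continuous_on (rectangle T) (fun q => f (fst q) (snd q)) -> forall t x,
  continuity_2d_pt (fun t x => Re (cl f t x)) t x /\
  continuity_2d_pt (fun t x => Im (cl f t x)) t x).
{ intros f Hf t x; split.
  - apply (continuity_2d_clamp T (fun q => Re (f (fst q) (snd q)))); [lra|].
    apply continuous_on_Re, Hf.
  - apply (continuity_2d_clamp T (fun q => Im (f (fst q) (snd q)))); [lra|].
    apply continuous_on_Im, Hf. }
assert (cx : forall f : R -> R -> C,
  continuous_on (rectangle T) (fun q => f (fst q) (snd q)) -> forall t x,
  continuous (fun x => Re (cl f t x)) x /\ continuous (fun x => Im (cl f t x)) x).
{ intros f Hf t x; destruct (clc f Hf t x) as [H1 H2].
  split; [apply (continuity_2d_slice (fun t x => Re (cl f t x)))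
         |apply (continuity_2d_slice (fun t x => Im (cl f t x)))]; assumption. }
pose (W := fun t x => Re (cl p t x) ^ 2 + Im (cl p t x) ^ 2).
pose (W' := fun t x => 2 * (Re (cl p t x) * Re (cl (Dt T p) t x)
                           + Im (cl p t x) * Im (cl (Dt T p) t x))).
pose (E := fun t : R => RInt (W t) 0 1 : R).
assert (HE : forall t, Icc 0 T t -> energy p t = E t).
{ intros t Ht; apply RInt_ext; rewrite Rmin_left, Rmax_right by lra.
  intros x Hx; unfold W; rewrite cl_id by (unfold Icc in *; lra).
  apply Cmod2_alt. }
assert (cW : forall t x, continuity_2d_pt W t x).
{ intros t x; destruct (clc p Hp t x) as [H1 H2]; unfold W.
  apply continuity_2d_pt_plus; simpl;
    repeat apply continuity_2d_pt_mult; try assumption;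
    apply continuity_2d_pt_const. }
assert (cW' : forall t x, continuity_2d_pt W' t x).
{ intros t x; destruct (clc p Hp t x) as [H1 H2].
  destruct (clc (Dt T p) Hpt t x) as [H3 H4]; unfold W'.
  apply continuity_2d_pt_mult; [apply continuity_2d_pt_const|].
  apply continuity_2d_pt_plus; apply continuity_2d_pt_mult; assumption. }
assert (dW : forall t x, 0 < t < T -> is_derive (fun tau => W tau x) t (W' t x)).
{ intros t x Ht; unfold W, W'.
  assert (Hx : Icc 0 1 (clamp 0 1 x)) by (apply clamp_Icc; lra).
  assert (Ht' : Icc 0 T t) by (unfold Icc; lra).
  destruct (is_derive_Re_Im_clamp 0 T (fun tau => p tau (clamp 0 1 x)) t Ht
    (proj1 (Hex t (clamp 0 1 x) Ht' Hx))) as [H1 H2].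
  change (CDerive_on 0 T (fun tau => p tau (clamp 0 1 x)) t)
    with (Dt T p t (clamp 0 1 x)) in H1, H2.
  assert (H3 : is_derive (fun y => y ^ 2) (Re (cl p t x)) (2 * Re (cl p t x)))
    by (auto_derive; [exact I|ring]).
  assert (H4 : is_derive (fun y => y ^ 2) (Im (cl p t x)) (2 * Im (cl p t x)))
    by (auto_derive; [exact I|ring]).
  assert (H5 := is_derive_comp _ _ _ _ _ H3 H1).
  assert (H6 := is_derive_comp _ _ _ _ _ H4 H2).
  assert (H7 := is_derive_plus _ _ _ _ _ H5 H6).
  replace (2 * _) with
    (plus (scal (Re (Dt T p t (clamp 0 1 x))) (2 * Re (cl p t x)))
          (scal (Im (Dt T p t (clamp 0 1 x))) (2 * Im (cl p t x)))); [exact H7|].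
  unfold plus, scal; simpl; unfold mult; simpl.
  unfold cl; rewrite (clamp_id 0 T t Ht'); ring. }
intros t Ht.
assert (H0 : Icc 0 T 0) by (unfold Icc; lra).
rewrite (HE t Ht), (HE 0 H0).
apply (gronwall E (fun t => RInt (W' t) 0 1) _ T);
  [intros; apply continuous_RInt_slice, cW| | |exact Ht].
{ intros; apply (is_derive_RInt_slice W W' 0 T); assumption. }
clear t Ht; intros t Ht.
assert (Ht' : Icc 0 T t) by (unfold Icc; lra).
(* The flux [2 Re (i alpha p_x conj p) + b x |p|^2] in real and imaginary
   parts.  In its derivative the products of [ux] with [vx] cancel. *)
pose (u := fun x => Re (cl p t x)); pose (v := fun x => Im (cl p t x)).
pose (ux := fun x => Re (cl (Dx p) t x)); pose (vx := fun x => Im (cl (Dx p) t x)).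
pose (uxx := fun x => Re (cl (Dx (Dx p)) t x)).
pose (vxx := fun x => Im (cl (Dx (Dx p)) t x)).
pose (F := fun x => 2 * alpha t * (ux x * v x - vx x * u x)
                    + b t * clamp 0 1 x * (u x ^ 2 + v x ^ 2)).
pose (F' := fun x => 2 * alpha t * (uxx x * v x - vxx x * u x)
                    + b t * (u x ^ 2 + v x ^ 2)
                    + 2 * b t * clamp 0 1 x * (u x * ux x + v x * vx x)).
assert (cc : forall x, continuous (clamp 0 1) x).
{ intros x; apply filterlim_locally; intros e; exists e; intros y Hy.
  apply Rle_lt_trans with (2 := Hy), clamp_lipschitz. }
assert (cF : forall x, continuous F x).
{ intros x; destruct (cx p Hp t x) as [H1 H2], (cx (Dx p) Hpx t x) as [H3 H4].
  exact (continuous_flux _ _ ux v vx u (clamp 0 1) x H3 H2 H4 H1 (cc x)). }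
assert (cF' : forall x, continuous F' x).
{ intros x; destruct (cx p Hp t x) as [H1 H2], (cx (Dx p) Hpx t x) as [H3 H4],
    (cx (Dx (Dx p)) Hpxx t x) as [H5 H6].
  exact (continuous_flux_derivative _ _ _ uxx v vxx u (clamp 0 1) ux vx x
    H5 H2 H6 H1 (cc x) H3 H4). }
assert (dF : forall x, 0 < x < 1 -> is_derive F x (F' x)).
{ intros x Hx; assert (Hx' : Icc 0 1 x) by (unfold Icc; lra).
  destruct (Hex t x Ht' Hx') as (_ & Hd1 & Hd2).
  destruct (is_derive_Re_Im_clamp 0 1 (p t) x Hx Hd1) as [H1 H2].
  destruct (is_derive_Re_Im_clamp 0 1 (Dx p t) x Hx Hd2) as [H3 H4].
  assert (du : is_derive u x (ux x)).
  { unfold u, ux; rewrite cl_id by assumption.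
    unfold cl; rewrite (clamp_id 0 T t Ht'); exact H1. }
  assert (dv : is_derive v x (vx x)).
  { unfold v, vx; rewrite cl_id by assumption.
    unfold cl; rewrite (clamp_id 0 T t Ht'); exact H2. }
  assert (dux : is_derive ux x (uxx x)).
  { unfold ux, uxx; rewrite cl_id by assumption.
    unfold cl; rewrite (clamp_id 0 T t Ht'); exact H3. }
  assert (dvx : is_derive vx x (vxx x)).
  { unfold vx, vxx; rewrite cl_id by assumption.
    unfold cl; rewrite (clamp_id 0 T t Ht'); exact H4. }
  assert (dF : is_derive (fun x => 2 * alpha t * (ux x * v x - vx x * u x)
                    + b t * x * (u x ^ 2 + v x ^ 2)) x (F' x)).
  { clearbody u v ux vx uxx vxx.
    assert (eu : Derive (fun y => u y) x = ux x) by exact (is_derive_unique _ _ _ du).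
    assert (ev : Derive (fun y => v y) x = vx x) by exact (is_derive_unique _ _ _ dv).
    assert (eux : Derive (fun y => ux y) x = uxx x)
      by exact (is_derive_unique _ _ _ dux).
    assert (evx : Derive (fun y => vx y) x = vxx x)
      by exact (is_derive_unique _ _ _ dvx).
    auto_derive; [repeat split; eexists; eassumption|].
    rewrite eu, ev, eux, evx; unfold F'; rewrite (clamp_id 0 1 x Hx'); ring. }
  revert dF; apply is_derive_ext_loc.
  generalize (locally_clamp 0 1 x Hx); apply filter_imp.
  intros y Hy; unfold F; rewrite Hy; reflexivity. }
assert (HF := RInt_interior_derivative F F' 0 1 Rlt_0_1 cF cF' dF).
assert (Hth : forall x, Icc 0 1 x -> Cmod (theta p t x) ^ 2 <= E t).
{ intros x Hx; apply (Cmod_CInt_le (p t) u v x Hx); try apply (cx p Hp t).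
  intros y Hy; unfold u, v; rewrite cl_id by assumption.
  apply surjective_pairing. }
assert (HM : 0 <= M) by (apply Rle_trans with (2 := Hb t Ht'), Rabs_pos).
(* The equation, multiplied by [2 conj p]. *)
assert (Hpt_le : forall x, Icc 0 1 x ->
  W' t x <= F' x + (4 * M * W t x + M * E t)).
{ intros x Hx; specialize (Hth x Hx).
  destruct (HGH t x Ht' Hx) as [HG HH].
  assert (Hlow := lower_order_le M (b t) (G t x) (H t x) (p t x) (theta p t x)
    (Hb t Ht') HG HH).
  unfold W' at 1, F', W at 1, u, v, ux, vx, uxx, vxx.
  rewrite !cl_id, clamp_id by assumption; rewrite (Hpde t x Ht' Hx).
  apply (Rmult_le_compat_l M) in Hth; [|exact HM].
  rewrite !Cmod2_alt in Hlow; rewrite Cmod2_alt in Hth.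
  revert Hlow Hth; generalize (E t).
  destruct (p t x) as [p1 p2], (theta p t x) as [w1 w2], (Dx p t x) as [a1 a2],
    (Dx (Dx p) t x) as [c1 c2], (G t x) as [g1 g2], (H t x) as [h1 h2].
  unfold Ci, RtoC, Cmult, Cplus, Cconj, Re, Im; simpl fst; simpl snd.
  intros E0 H1 H2; lra. }
assert (HF01 : F 1 - F 0 <= N * E t).
{ assert (I0 : Icc 0 1 0) by (unfold Icc; lra).
  assert (I1 : Icc 0 1 1) by (unfold Icc; lra).
  specialize (Hth 1 I1).
  apply Rle_trans with (N * Cmod (theta p t 1) ^ 2);
    [|apply Rmult_le_compat_l; assumption].
  apply Rle_trans with (2 := Hbd t (p t 1) (theta p t 1) Ht').
  unfold F, u, v, ux, vx; rewrite !cl_id, !clamp_id by assumption.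
  specialize (Hr t Ht'); rewrite (Hl t Ht').
  rewrite Cmod2_alt; revert Hr.
  destruct (p t 1) as [p1 p2], (theta p t 1) as [w1 w2], (Dx p t 1) as [a1 a2],
    (kappa t) as [k1 k2], (p t 0) as [z1 z2].
  unfold Ci, RtoC, Cmult, Cplus, Cminus, Copp, Cconj, Re, Im; simpl fst; simpl snd.
  intros Hr; injection Hr; intros Hr2 Hr1.
  apply (f_equal (Rmult p1)) in Hr1; apply (f_equal (Rmult p2)) in Hr2; lra. }
assert (cWx : forall x, continuous (W t) x)
  by (intros; apply continuity_2d_slice, cW).
assert (HR : is_RInt (fun x => F' x + (4 * M * W t x + M * E t)) 0 1
  ((F 1 - F 0) + (4 * M * E t + (1 - 0) * (M * E t)))).
{ rewrite <- HF.
  apply (is_RInt_plus (V := R_NormedModule)).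
  { apply (RInt_correct (V := R_CompleteNormedModule)).
    apply ex_RInt_everywhere_continuous, cF'. }
  apply (is_RInt_plus (V := R_NormedModule)).
  - apply (is_RInt_scal (V := R_NormedModule)).
    apply (RInt_correct (V := R_CompleteNormedModule)).
    apply ex_RInt_everywhere_continuous, cWx.
  - apply (is_RInt_const (V := R_NormedModule)). }
apply Rle_trans with
  (RInt (fun x => F' x + (4 * M * W t x + M * E t)) 0 1).
- apply RInt_le; [lra|apply ex_RInt_slice, cW'|eexists; exact HR|].
  intros x Hx; apply Hpt_le; unfold Icc; lra.
- rewrite (is_RInt_unique _ _ _ _ HR); lra.
Qed.

(** * Functions bounded on the rectangle *)

Definition bounded (T : R) (f : R -> R -> C) : Prop :=
  exists M, forall t x, Icc 0 T t -> Icc 0 1 x -> Cmod (f t x) <= M.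

Lemma bounded_ext (T : R) (f g : R -> R -> C) :
  (forall t x, Icc 0 T t -> Icc 0 1 x -> f t x = g t x) ->
  bounded T f -> bounded T g.
Proof.
intros E [M HM]; exists M; intros t x Ht Hx; rewrite <- E by assumption; auto.
Qed.

Lemma bounded_plus (T : R) (f g : R -> R -> C) :
  bounded T f -> bounded T g -> bounded T (fun t x => f t x + g t x)%C.
Proof.
intros [M HM] [N HN]; exists (M + N); intros t x Ht Hx.
apply Rle_trans with (1 := Cmod_triangle _ _), Rplus_le_compat; auto.
Qed.

Lemma bounded_mult (T : R) (f g : R -> R -> C) :
  bounded T f -> bounded T g -> bounded T (fun t x => f t x * g t x)%C.
Proof.
intros [M HM] [N HN]; exists (M * N); intros t x Ht Hx.
rewrite Cmod_mult; apply Rmult_le_compat; auto using Cmod_ge_0.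
Qed.

Lemma bounded_opp (T : R) (f : R -> R -> C) :
  bounded T f -> bounded T (fun t x => - f t x)%C.
Proof.
intros [M HM]; exists M; intros t x Ht Hx; rewrite Cmod_opp; auto.
Qed.

Lemma bounded_minus (T : R) (f g : R -> R -> C) :
  bounded T f -> bounded T g -> bounded T (fun t x => f t x - g t x)%C.
Proof. intros; apply bounded_plus; [|apply bounded_opp]; assumption. Qed.

Lemma bounded_const (T : R) (c : C) : bounded T (fun _ _ => c).
Proof. exists (Cmod c); intros; apply Rle_refl. Qed.

Lemma bounded_space_variable (T : R) : bounded T (fun _ x => RtoC x).
Proof.
exists 1; intros t x _ [H1 H2]; rewrite Cmod_R, Rabs_right; lra.
Qed.

Lemma bounded_RtoC_plus (T : R) (f g : R -> R -> R) :
  bounded T (fun t x => RtoC (f t x)) -> bounded T (fun t x => RtoC (g t x)) ->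
  bounded T (fun t x => RtoC (f t x + g t x)).
Proof.
intros Hf Hg; eapply bounded_ext, (bounded_plus _ _ _ Hf Hg).
intros; simpl; rewrite RtoC_plus; reflexivity.
Qed.

Lemma bounded_RtoC_minus (T : R) (f g : R -> R -> R) :
  bounded T (fun t x => RtoC (f t x)) -> bounded T (fun t x => RtoC (g t x)) ->
  bounded T (fun t x => RtoC (f t x - g t x)).
Proof.
intros Hf Hg; eapply bounded_ext, (bounded_minus _ _ _ Hf Hg).
intros; simpl; rewrite RtoC_minus; reflexivity.
Qed.

Lemma bounded_RtoC_mult (T : R) (f g : R -> R -> R) :
  bounded T (fun t x => RtoC (f t x)) -> bounded T (fun t x => RtoC (g t x)) ->
  bounded T (fun t x => RtoC (f t x * g t x)).
Proof.
intros Hf Hg; eapply bounded_ext, (bounded_mult _ _ _ Hf Hg).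
intros; simpl; rewrite RtoC_mult; reflexivity.
Qed.

Lemma bounded_RtoC_sqr (T : R) (f : R -> R -> R) :
  bounded T (fun t x => RtoC (f t x)) -> bounded T (fun t x => RtoC (f t x ^ 2)).
Proof.
intros Hf; eapply bounded_ext, (bounded_RtoC_mult _ _ _ Hf Hf).
intros; simpl; f_equal; ring.
Qed.

(** Reduces boundedness of an algebraic expression to hypotheses; inverses are
    atoms. *)
Ltac bounded_algebra :=
  lazymatch goal with
  | |- bounded _ (fun t x => RtoC (@?f t x - @?g t x)) =>
      apply (bounded_RtoC_minus _ f g); bounded_algebra
  | |- bounded _ (fun t x => RtoC (@?f t x + @?g t x)) =>
      apply (bounded_RtoC_plus _ f g); bounded_algebra
  | |- bounded _ (fun t x => RtoC (@?f t x * @?g t x)) =>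
      apply (bounded_RtoC_mult _ f g); bounded_algebra
  | |- bounded _ (fun t x => RtoC (@?f t x / @?g t x)) =>
      apply (bounded_RtoC_mult _ f (fun t x => / g t x)); bounded_algebra
  | |- bounded _ (fun t x => RtoC (@?f t x ^ 2)) =>
      apply (bounded_RtoC_sqr _ f); bounded_algebra
  | |- bounded _ (fun t x => (@?f t x - @?g t x)%C) =>
      apply (bounded_minus _ f g); bounded_algebra
  | |- bounded _ (fun t x => (@?f t x + @?g t x)%C) =>
      apply (bounded_plus _ f g); bounded_algebra
  | |- bounded _ (fun t x => (@?f t x * @?g t x)%C) =>
      apply (bounded_mult _ f g); bounded_algebra
  | _ => first [assumption|apply bounded_const|apply bounded_space_variable]
  end.

Lemma continuous_on_bounded (T : R) (f : R -> R -> C) :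
  continuous_on (rectangle T) (fun q => f (fst q) (snd q)) -> bounded T f.
Proof.
intros Hf.
destruct (continuous_on_rectangle_bounded (V := C_R_NormedModule) T
  (fun q => f (fst q) (snd q)) Hf) as [M HM].
exists M; intros t x Ht Hx; rewrite Cmod_norm; exact (HM (t, x) (conj Ht Hx)).
Qed.

Lemma filterlim_fst_rectangle {V : UniformSpace} (T : R) (f : R -> V)
    (q : R * R) :
  filterlim f (within (Icc 0 T) (locally (fst q))) (locally (f (fst q))) ->
  filterlim (fun q => f (fst q)) (within (rectangle T) (locally q))
    (locally (f (fst q))).
Proof.
apply filterlim_comp; intros P [d Hd]; exists d; intros y Hy [Hy1 _].
exact (Hd (fst y) (proj1 Hy) Hy1).
Qed.

Lemma is_derive_on_bounded_C (T : R) (f f' : R -> C) :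
  (forall t, Icc 0 T t -> is_derive_on (V := C_R_NormedModule) 0 T f t (f' t)) ->
  bounded T (fun t _ => f t).
Proof.
intros Hf; apply (continuous_on_bounded T (fun t _ => f t)); intros q [Hq _].
apply (filterlim_fst_rectangle (V := C_R_NormedModule) T f q).
exact (is_derive_on_continuous (V := C_R_NormedModule) 0 T f _ _ (Hf _ Hq)).
Qed.

Lemma is_derive_on_bounded (T : R) (f f' : R -> R) :
  (forall t, Icc 0 T t -> is_derive_on (V := R_NormedModule) 0 T f t (f' t)) ->
  bounded T (fun t _ => RtoC (f t)).
Proof.
intros Hf; apply (is_derive_on_bounded_C T (fun t => RtoC (f t))
  (fun t => (f' t, 0))); intros t Ht.
apply is_derive_on_pair; [apply Hf, Ht|].
apply (is_derive_on_const (V := R_NormedModule)).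
Qed.

(** * The coefficients of the equation *)

(** [zeta t x] is [i/2] times this amplitude times [x ^ 2]. *)
Definition zeta_amplitude (T eps : R) (s : R -> R) (t : R) : R :=
  (sigma T eps s t - 1) * sdot T s t * s t.

(** The first-order coefficient is [x] times the drift, see [coefB_eq]. *)
Definition drift (T eps : R) (s : R -> R) (t : R) : R :=
  sdot T s t / s t * sigma T eps s t.

Lemma Dx_unique (f : R -> R -> C) (t x : R) (l : C) :
  Icc 0 1 x -> is_derive_on (V := C_R_NormedModule) 0 1 (f t) x l ->
  Dx f t x = l.
Proof.
intros Hx Hl.
exact (is_derive_on_unique (V := C_R_CompleteNormedModule) 0 1 (f t) x l
  Rlt_0_1 Hx Hl).
Qed.

Lemma Dx_zeta (T eps : R) (s : R -> R) (t x : R) :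
  Icc 0 1 x ->
  Dx (zeta T eps s) t x = (Ci * RtoC (zeta_amplitude T eps s t * x))%C.
Proof.
intros Hx; apply Dx_unique; [exact Hx|].
assert (H : is_derive_on (V := C_R_NormedModule) 0 1
  (fun y => Ci / 2 * RtoC (zeta_amplitude T eps s t * y ^ 2))%C x
  (Ci / 2 * RtoC (zeta_amplitude T eps s t * (2 * x)))%C).
{ apply is_derive_on_CRmult; [lra|exact Hx|].
  apply (is_derive_on_is_derive (V := R_NormedModule)); [lra|exact Hx|auto_derive; [exact I|ring]]. }
replace (Ci * _)%C with (Ci / 2 * RtoC (zeta_amplitude T eps s t * (2 * x)))%C;
  [exact H|].
rewrite !RtoC_mult; field.
Qed.

Lemma Dxx_zeta (T eps : R) (s : R -> R) (t x : R) :
  Icc 0 1 x ->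
  Dx (Dx (zeta T eps s)) t x = (Ci * RtoC (zeta_amplitude T eps s t))%C.
Proof.
intros Hx; apply Dx_unique; [exact Hx|].
apply (is_derive_on_ext (V := C_R_NormedModule) 0 1
  (fun y => Ci * RtoC (zeta_amplitude T eps s t * y))%C); [lra|exact Hx| |].
- intros y Hy; symmetry; apply Dx_zeta, Hy.
- apply is_derive_on_CRmult; [lra|exact Hx|].
  apply (is_derive_on_is_derive (V := R_NormedModule)); [lra|exact Hx|auto_derive; [exact I|ring]].
Qed.

Lemma Dt_zeta (T eps : R) (s : R -> R) (t x c' : R) :
  0 < T -> Icc 0 T t ->
  is_derive_on (V := R_NormedModule) 0 T (zeta_amplitude T eps s) t c' ->
  Dt T (zeta T eps s) t x = (Ci / 2 * RtoC (c' * x ^ 2))%C.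
Proof.
intros HT Ht Hc.
apply (is_derive_on_unique (V := C_R_CompleteNormedModule) 0 T
  (fun tau => zeta T eps s tau x) t _ HT Ht).
apply (is_derive_on_CRmult 0 T (Ci / 2) (fun tau => zeta_amplitude T eps s tau * x ^ 2));
  [exact HT|exact Ht|].
replace (c' * x ^ 2) with (c' * x ^ 2 + zeta_amplitude T eps s t * 0) by ring.
apply (is_derive_on_mult 0 T (zeta_amplitude T eps s) (fun _ => x ^ 2));
  [exact HT|exact Ht|exact Hc|apply (is_derive_on_const (V := R_NormedModule))].
Qed.

(** The drift is real: this is what the phase [zeta] is chosen for. *)
Lemma coefB_eq (T eps : R) (s : R -> R) (t x : R) :
  s t <> 0 -> Icc 0 1 x ->
  coefB T eps s t x = RtoC (x * drift T eps s t).
Proof.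
intros Hs Hx; unfold coefB; rewrite Dx_zeta by exact Hx.
unfold zeta_amplitude, drift, Cdiv.
rewrite <- RtoC_inv by (apply pow_nonzero, Hs).
apply injective_projections; simpl; field; exact Hs.
Qed.

Lemma Dx_coefB (T eps : R) (s : R -> R) (t x : R) :
  s t <> 0 -> Icc 0 1 x -> Dx (coefB T eps s) t x = RtoC (drift T eps s t).
Proof.
intros Hs Hx; apply Dx_unique; [exact Hx|].
apply (is_derive_on_ext (V := C_R_NormedModule) 0 1
  (fun y => 1 * RtoC (y * drift T eps s t))%C); [lra|exact Hx| |].
- intros y Hy; rewrite coefB_eq, Cmult_1_l by assumption; reflexivity.
- rewrite <- (Cmult_1_l (RtoC (drift T eps s t))).
  apply is_derive_on_CRmult; [lra|exact Hx|].
  apply (is_derive_on_is_derive (V := R_NormedModule)); [lra|exact Hx|auto_derive; [exact I|ring]].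
Qed.

(** The bracket in [G] is where a real term arises: [i/(2 s^2) (i c x)^2] is
    imaginary like [zeta], but [- i/(2 s^2) (i c)], from [zeta_xx], is real. *)
Lemma coefG_eq (T eps : R) (s : R -> R) (gamma : R -> R -> C) (t x c' : R) :
  0 < T -> s t <> 0 -> Icc 0 T t -> Icc 0 1 x ->
  is_derive_on (V := R_NormedModule) 0 T (zeta_amplitude T eps s) t c' ->
  let c := zeta_amplitude T eps s t in
  coefG T eps s gamma t x =
    (RtoC (c / (2 * s t ^ 2))
     + Ci * RtoC ((c' / 2 - sdot T s t / s t * c - c ^ 2 / (2 * s t ^ 2)) * x ^ 2)
     + Ci * gamma t (x * s t)%R)%C.
Proof.
intros HT Hs Ht Hx Hc c; unfold coefG.
rewrite (Dt_zeta T eps s t x c' HT Ht Hc), Dx_zeta, Dxx_zeta by exact Hx.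
fold c; unfold Cdiv.
assert (Hs2 : 2 * s t ^ 2 <> 0) by (assert (H := pow_nonzero _ 2 Hs); lra).
rewrite <- (RtoC_inv 2), <- (RtoC_inv _ Hs2) by lra.
destruct (gamma t (x * s t)) as [g1 g2].
apply injective_projections; simpl; field; exact Hs.
Qed.

(** The segment [{t} x [0, s(t)]] lies in the region below the profile, so the
    derivative of [gamma] within that region can be composed with it. *)
Lemma is_derive_on_gamma (T : R) (s : R -> R) (gamma : R -> R -> C)
    (D : R * R -> C) (gamma_t gamma_y : R * R -> C) (t x : R) :
  Icc 0 T t -> Icc 0 1 x -> 0 < s t ->
  (forall q, profile_region T s q -> D q = gamma (fst q) (snd q)) ->
  (forall q, profile_region T s q ->
     filterdiff (V := C_R_NormedModule) D
       (within (profile_region T s) (locally q))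
       (fun h : R * R =>
          plus (scal (V := C_R_NormedModule) (fst h) (gamma_t q))
               (scal (V := C_R_NormedModule) (snd h) (gamma_y q)))) ->
  is_derive_on (V := C_R_NormedModule) 0 1 (fun y => gamma t (y * s t)) x
    (RtoC (s t) * gamma_y (t, x * s t)%R)%C.
Proof.
intros Ht Hx Hs HD Hd.
assert (Hin : forall y, Icc 0 1 y -> profile_region T s (t, y * s t)).
{ intros y [Hy0 Hy1]; split; [exact Ht|simpl; split; nra]. }
apply (is_derive_on_ext (V := C_R_NormedModule) 0 1 (fun y => D (t, y * s t)));
  [lra|exact Hx|intros y Hy; apply (HD _ (Hin y Hy))|].
assert (Hpath : filterdiff (K := R_AbsRing) (U := R_NormedModule)
  (V := prod_NormedModule R_AbsRing R_NormedModule R_NormedModule)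
  (fun y : R => (t, y * s t)) (within (Icc 0 1) (locally x))
  (fun h : R => scal h (0, s t))).
{ apply (is_derive_on_pair 0 1 (fun _ => t) (fun y => y * s t) x 0 (s t)).
  - apply (is_derive_on_const (V := R_NormedModule)).
  - apply (is_derive_on_is_derive (V := R_NormedModule)); [lra|exact Hx|auto_derive; [exact I|ring]]. }
assert (H := filterdiff_comp_within (U := R_NormedModule)
  (V := prod_NormedModule R_AbsRing R_NormedModule R_NormedModule)
  (W := C_R_NormedModule) (Icc 0 1) (profile_region T s)
  (fun y : R => (t, y * s t)) D _ _ x
  (within_Icc_proper 0 1 x Rlt_0_1 Hx) Hin Hpath (Hd _ (Hin x Hx))).
apply (filterdiff_ext_lin _ _ _ H); intros h.
apply injective_projections; unfold plus, scal; simpl;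
  unfold plus, scal; simpl; unfold mult; simpl; ring.
Qed.

Lemma Dx_coefG (T eps : R) (s : R -> R) (gamma : R -> R -> C) (t x c' : R)
    (gamma_y : C) :
  0 < T -> s t <> 0 -> Icc 0 T t -> Icc 0 1 x ->
  is_derive_on (V := R_NormedModule) 0 T (zeta_amplitude T eps s) t c' ->
  is_derive_on (V := C_R_NormedModule) 0 1 (fun y => gamma t (y * s t)) x
    (RtoC (s t) * gamma_y)%C ->
  let c := zeta_amplitude T eps s t in
  Dx (coefG T eps s gamma) t x =
    (Ci * RtoC ((c' / 2 - sdot T s t / s t * c - c ^ 2 / (2 * s t ^ 2)) * (2 * x))
     + Ci * (RtoC (s t) * gamma_y))%C.
Proof.
intros HT Hs Ht Hx Hc Hg c; apply Dx_unique; [exact Hx|].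
pose (a := c' / 2 - sdot T s t / s t * c - c ^ 2 / (2 * s t ^ 2)).
apply (is_derive_on_ext (V := C_R_NormedModule) 0 1
  (fun y => (RtoC (c / (2 * s t ^ 2)) + Ci * RtoC (a * y ^ 2))
            + Ci * gamma t (y * s t)%R)%C); [lra|exact Hx| |].
{ intros y Hy; symmetry; exact (coefG_eq T eps s gamma t y c' HT Hs Ht Hy Hc). }
apply (is_derive_on_plus (V := C_R_NormedModule) 0 1
  (fun y => RtoC (c / (2 * s t ^ 2)) + Ci * RtoC (a * y ^ 2))%C).
- rewrite <- (Cplus_0_l (Ci * RtoC (_ * (2 * x)))).
  apply (is_derive_on_plus (V := C_R_NormedModule) 0 1
    (fun y => RtoC (c / (2 * s t ^ 2))) (fun y => Ci * RtoC (a * y ^ 2))%C).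
  + apply (is_derive_on_const (V := C_R_NormedModule)).
  + apply is_derive_on_CRmult; [lra|exact Hx|].
    apply (is_derive_on_is_derive (V := R_NormedModule)); [lra|exact Hx|auto_derive; [exact I|unfold a; ring]].
- apply (is_derive_on_linear (V := C_R_NormedModule) (W := C_R_NormedModule) 0 1
    (Cmult Ci) (fun y => gamma t (y * s t))); [apply is_linear_Cmult|exact Hg].
Qed.

(** The graph of a differentiable profile is continuous, so a function that is
    differentiable below the profile is bounded in the rescaled variable. *)
Lemma bounded_below_profile (T : R) (s s' : R -> R) (D : R * R -> C)
    (L : R * R -> R * R -> C) :
  (forall t, Icc 0 T t -> 0 < s t) ->
  (forall t, Icc 0 T t -> is_derive_on (V := R_NormedModule) 0 T s t (s' t)) ->
  (forall q, profile_region T s q ->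
     filterdiff (K := R_AbsRing)
       (U := prod_NormedModule R_AbsRing R_NormedModule R_NormedModule)
       (V := C_R_NormedModule) D
       (within (profile_region T s) (locally q)) (L q)) ->
  bounded T (fun t x => D (t, x * s t)).
Proof.
intros Hpos Hs HD; apply continuous_on_bounded; intros q Hq.
assert (Hin : forall q, rectangle T q ->
  profile_region T s (fst q, snd q * s (fst q))).
{ intros [t y] [Ht [Hy0 Hy1]]; simpl in *; split; [exact Ht|simpl].
  specialize (Hpos t Ht); split; nra. }
assert (Hc : filterlim D
  (within (profile_region T s) (locally (fst q, snd q * s (fst q))))
  (locally (D (fst q, snd q * s (fst q))))).
{ apply (filterdiff_continuous_aux (K := R_AbsRing)
    (U := prod_NormedModule R_AbsRing R_NormedModule R_NormedModule)
    (V := C_R_NormedModule));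
    [eexists; apply HD, Hin, Hq|].
  apply (is_filter_lim_within
    (U := prod_UniformSpace R_UniformSpace R_UniformSpace)). }
apply filterlim_comp with (2 := Hc); clear Hc.
assert (H1 : filterlim (fun q : R * R => snd q)
  (within (rectangle T) (locally q)) (locally (snd q))).
{ intros P [d Hd]; exists d; intros y Hy _; apply Hd, Hy. }
assert (H0 : filterlim (fun q : R * R => fst q)
  (within (rectangle T) (locally q)) (locally (fst q))).
{ intros P [d Hd]; exists d; intros y Hy _; apply Hd, Hy. }
assert (H2 := filterlim_fst_rectangle (V := R_UniformSpace) T s q
  (is_derive_on_continuous (V := R_NormedModule) 0 T s _ _ (Hs _ (proj1 Hq)))).
assert (H3 : filterlim (fun q : R * R => snd q * s (fst q))
  (within (rectangle T) (locally q)) (locally (snd q * s (fst q)))).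
{ apply (filterlim_comp_2 _ _ Rmult H1 H2).
  apply (filterlim_mult (K := R_AbsRing)). }
intros P [d Hd].
assert (K0 := H0 _ (locally_ball (fst q) d)).
assert (K3 := H3 _ (locally_ball (snd q * s (fst q)) d)).
unfold filtermap, within in K0, K3 |- *.
generalize (filter_and _ _ K0 K3); apply filter_imp.
intros y [J0 J3] Hy; apply Hd; [split; [exact (J0 Hy)|exact (J3 Hy)]|].
apply Hin, Hy.
Qed.

(** Three derivatives: the second one occurs in [zeta_t] and is bounded because
    it is differentiable. *)
Lemma smooth_profile (T : R) (s : R -> R) :
  0 < T -> smooth_on (V := R_NormedModule) 0 T s ->
  exists s2 s3 : R -> R, forall t, Icc 0 T t ->
    is_derive_on (V := R_NormedModule) 0 T s t (sdot T s t) /\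
    is_derive_on (V := R_NormedModule) 0 T (sdot T s) t (s2 t) /\
    is_derive_on (V := R_NormedModule) 0 T s2 t (s3 t).
Proof.
intros HT (D & HD0 & HD).
assert (Hs : forall t, Icc 0 T t ->
  is_derive_on (V := R_NormedModule) 0 T s t (D 1%nat t)).
{ intros t Ht; apply (is_derive_on_ext (V := R_NormedModule) 0 T (D 0%nat));
    [exact HT|exact Ht|exact HD0|apply HD, Ht]. }
assert (Hd : forall t, Icc 0 T t -> sdot T s t = D 1%nat t).
{ intros t Ht.
  exact (is_derive_on_unique (V := R_CompleteNormedModule) 0 T s t _ HT Ht (Hs t Ht)). }
exists (D 2%nat), (D 3%nat); intros t Ht; rewrite Hd by exact Ht.
split; [apply Hs, Ht|split; [|apply HD, Ht]].
apply (is_derive_on_ext (V := R_NormedModule) 0 T (D 1%nat));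
  [exact HT|exact Ht| |apply HD, Ht].
intros y Hy; symmetry; apply Hd, Hy.
Qed.

Lemma bounded_inv (T : R) (f f' : R -> R) :
  0 < T ->
  (forall t, Icc 0 T t -> is_derive_on (V := R_NormedModule) 0 T f t (f' t)) ->
  (forall t, Icc 0 T t -> f t <> 0) -> bounded T (fun t _ => RtoC (/ f t)).
Proof.
intros HT Hf Hne.
apply (is_derive_on_bounded T (fun t => / f t) (fun t => f' t * (- / f t ^ 2))).
intros t Ht; apply (is_derive_on_comp 0 T Rinv f); [exact HT|exact Ht|apply Hf, Ht|].
auto_derive; [apply Hne, Ht|field; apply Hne, Ht].
Qed.

Definition strictly_monotone (T : R) (s : R -> R) : Prop :=
  (forall t, Icc 0 T t -> 0 < sdot T s t) \/
  (forall t, Icc 0 T t -> sdot T s t < 0).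

(** With [d = s'], the amplitude is [k(d) s] for a rational function [k] without
    poles off [0] when the profile increases, and zero when it decreases. *)
Lemma zeta_amplitude_derive (T eps : R) (s s2 : R -> R) :
  0 < T -> strictly_monotone T s ->
  (forall t, Icc 0 T t ->
     is_derive_on (V := R_NormedModule) 0 T s t (sdot T s t) /\
     is_derive_on (V := R_NormedModule) 0 T (sdot T s) t (s2 t)) ->
  bounded T (fun t _ => RtoC (s t)) -> bounded T (fun t _ => RtoC (sdot T s t)) ->
  bounded T (fun t _ => RtoC (/ sdot T s t)) -> bounded T (fun t _ => RtoC (s2 t)) ->
  exists c' : R -> R, bounded T (fun t _ => RtoC (c' t)) /\
    forall t, Icc 0 T t ->
      is_derive_on (V := R_NormedModule) 0 T (zeta_amplitude T eps s) t (c' t).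
Proof.
intros HT [Hpos|Hneg] Hs Bs Bd Bdi Bd2.
- pose (k := fun y => (2 * (1 + y ^ 2) / y ^ 2 + eps - 1) * y).
  exists (fun t => (s2 t * (1 + eps - 2 * (/ sdot T s t) ^ 2)) * s t
                   + ((2 * (1 + sdot T s t ^ 2) * (/ sdot T s t) ^ 2 + eps - 1)
                      * sdot T s t) * sdot T s t); split; [bounded_algebra|].
  intros t Ht; assert (H0 : sdot T s t <> 0) by (specialize (Hpos t Ht); lra).
  apply (is_derive_on_ext (V := R_NormedModule) 0 T (fun t => k (sdot T s t) * s t));
    [exact HT|exact Ht| |].
  { intros y Hy; unfold zeta_amplitude, sigma, k.
    match goal with |- ?a = ?b => change (@eq R a b) end.
    specialize (Hpos y Hy); destruct (Rlt_dec 0 (sdot T s y)); [ring|contradiction]. }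
  rewrite pow_inv.
  change ((2 * (1 + sdot T s t ^ 2) * / sdot T s t ^ 2 + eps - 1) * sdot T s t)
    with (k (sdot T s t)).
  apply (is_derive_on_mult 0 T (fun t => k (sdot T s t)) s);
    [exact HT|exact Ht| |apply Hs, Ht].
  apply (is_derive_on_comp 0 T k); [exact HT|exact Ht|apply Hs, Ht|].
  unfold k; auto_derive; [apply (pow_nonzero _ 2 H0)|field; exact H0].
- exists (fun _ => 0); split; [apply bounded_const|].
  intros t Ht; apply (is_derive_on_ext (V := R_NormedModule) 0 T (fun _ => 0));
    [exact HT|exact Ht| |apply (is_derive_on_const (V := R_NormedModule))].
  intros y Hy; unfold zeta_amplitude, sigma.
  match goal with |- ?a = ?b => change (@eq R a b) end.
  specialize (Hneg y Hy); destruct (Rlt_dec 0 (sdot T s y)); [lra|ring].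
Qed.

(** At [x = 1] the flux contains [|p|^2] with the coefficient [2 / R1 - drift].
    For an increasing profile [2 / R1] is positive and [sigma] is chosen to make
    the drift exceed it by [eps s' / s].  For a decreasing profile, [sigma = 1]
    suffices, since [2 / R1] is negative and larger than the drift in absolute
    value.  The gap is bounded below in the form [1 <= L * gap]. *)
Lemma drift_dominates (T eps : R) (s : R -> R) :
  0 < eps -> (forall t, Icc 0 T t -> 0 < s t) -> strictly_monotone T s ->
  bounded T (fun t _ => RtoC (s t)) -> bounded T (fun t _ => RtoC (sdot T s t)) ->
  bounded T (fun t _ => RtoC (/ sdot T s t)) ->
  exists L, 0 <= L /\ forall t, Icc 0 T t ->
    0 < drift T eps s t - 2 / coefR1 T s t /\
    1 <= L * (drift T eps s t - 2 / coefR1 T s t).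
Proof.
intros Heps Hs [Hpos|Hneg] Bs Bd Bdi.
- assert (B : bounded T (fun t _ => RtoC (s t * / sdot T s t))) by bounded_algebra.
  destruct B as [L HL]; exists (Rabs L / eps); split.
  { apply Rmult_le_pos; [apply Rabs_pos|apply Rlt_le, Rinv_0_lt_compat, Heps]. }
  intros t Ht; specialize (HL t 0 Ht (conj (Rle_refl 0) Rle_0_1)).
  specialize (Hpos t Ht); specialize (Hs t Ht).
  assert (Hc : 0 < sdot T s t / s t) by (apply Rdiv_lt_0_compat; assumption).
  assert (E : drift T eps s t - 2 / coefR1 T s t = eps * (sdot T s t / s t)).
  { unfold drift, sigma, coefR1; destruct (Rlt_dec 0 (sdot T s t)); [|lra].
    field; repeat split; try lra; nra. }
  rewrite E; split; [apply Rmult_lt_0_compat; assumption|].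
  rewrite Cmod_R in HL.
  replace (Rabs L / eps * (eps * (sdot T s t / s t)))
    with (Rabs L * (sdot T s t / s t)) by (field; lra).
  replace 1 with (s t * / sdot T s t * (sdot T s t / s t)) by (field; lra).
  apply Rmult_le_compat_r; [lra|].
  apply Rle_trans with (1 := Rle_abs _), Rle_trans with (1 := HL), Rle_abs.
- assert (B : bounded T (fun t _ => RtoC (s t * sdot T s t))) by bounded_algebra.
  destruct B as [L HL]; exists (Rabs L); split; [apply Rabs_pos|].
  intros t Ht; specialize (HL t 0 Ht (conj (Rle_refl 0) Rle_0_1)).
  specialize (Hneg t Ht); specialize (Hs t Ht).
  assert (Hq : 0 < s t * - sdot T s t) by (apply Rmult_lt_0_compat; lra).
  assert (E : drift T eps s t - 2 / coefR1 T s t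
              = (2 + sdot T s t ^ 2) / (s t * - sdot T s t)).
  { unfold drift, sigma, coefR1; destruct (Rlt_dec 0 (sdot T s t)); [lra|].
    field; repeat split; try lra; nra. }
  assert (H2 := pow2_ge_0 (sdot T s t)).
  rewrite E; split; [apply Rdiv_lt_0_compat; lra|].
  rewrite Cmod_R in HL.
  assert (HL' : s t * - sdot T s t <= Rabs L).
  { replace (s t * - sdot T s t) with (- (s t * sdot T s t)) by ring.
    apply Rle_trans with (1 := Rle_abs _); rewrite Rabs_Ropp.
    apply Rle_trans with (1 := HL), Rle_abs. }
  replace 1 with (s t * - sdot T s t * (1 / (s t * - sdot T s t))) by (field; lra).
  apply Rmult_le_compat; [lra| |exact HL'|].
  + apply Rlt_le, Rdiv_lt_0_compat; lra.
  + apply Rmult_le_compat_r; [apply Rlt_le, Rinv_0_lt_compat, Hq|lra].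
Qed.

(** Young's inequality: since [1 <= L delta], the claim multiplied by [delta]
    follows from the square of [M |w| - delta |z|] being nonnegative. *)
Lemma boundary_dissipation (delta L M : R) (k w z : C) :
  0 < delta -> 1 <= L * delta -> Cmod k <= M ->
  - delta * Cmod z ^ 2 - 2 * Re (k * w * Cconj z) <= M ^ 2 * L * Cmod w ^ 2.
Proof.
intros Hd HL Hk.
assert (H1 := Re_mult_conj_le (- (k * w))%C z).
rewrite Cmod_opp, Cmod_mult in H1.
replace (- (k * w) * Cconj z)%C with (- (k * w * Cconj z))%C in H1 by ring.
assert (E : forall c, Re (- c) = - Re c) by reflexivity; rewrite E in H1.
assert (Hz := Cmod_ge_0 z); assert (Hw := Cmod_ge_0 w).
assert (H2 : Cmod k * Cmod w * Cmod z <= M * Cmod w * Cmod z).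
{ apply Rmult_le_compat_r; [exact Hz|apply Rmult_le_compat_r; assumption]. }
assert (H3 := pow2_ge_0 (M * Cmod w - delta * Cmod z)).
assert (H4 : (M * Cmod w) ^ 2 * 1 <= (M * Cmod w) ^ 2 * (L * delta))
  by (apply Rmult_le_compat_l; [apply pow2_ge_0|exact HL]).
apply Rle_trans with (- delta * Cmod z ^ 2 + 2 * (M * Cmod w * Cmod z)); [lra|].
apply (Rmult_le_reg_l delta); [exact Hd|]; nra.
Qed.

Lemma coefR1_neq_0 (T : R) (s : R -> R) (t : R) :
  sdot T s t <> 0 -> s t <> 0 -> coefR1 T s t <> 0.
Proof.
intros Hd Hs; unfold coefR1; assert (H := pow2_ge_0 (sdot T s t)).
apply Rmult_integral_contrapositive_currified;
  [apply Rmult_integral_contrapositive_currified; assumption|].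
apply Rinv_neq_0_compat; lra.
Qed.

Definition boundary_theta_coef (T eps : R) (s : R -> R) (g : R -> C)
    (gamma : R -> R -> C) (t : R) : C :=
  ((RtoC (coefR1 T s t) * coefG T eps s gamma t 1 + coefR2 T eps s g t)
   / RtoC (coefR1 T s t))%C.

(** The explicit formulas for the coefficients are polynomials in [x] and in
    functions of [t], their inverses, and [gamma], [gamma_y] along the rescaled
    profile, each of which is continuous on a compact set. *)
Lemma coefficients_bounded (T eps : R) (s : R -> R) (g : R -> C)
    (gamma : R -> R -> C) :
  0 < T -> 0 < eps -> (forall t, Icc 0 T t -> 0 < s t) ->
  smooth_on (V := R_NormedModule) 0 T s ->
  smooth_on (V := C_R_NormedModule) 0 T g ->
  smooth_on2 (profile_region T s) gamma -> strictly_monotone T s ->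
  exists M L, 0 <= M /\ 0 <= L /\ forall t, Icc 0 T t ->
    (0 < drift T eps s t - 2 / coefR1 T s t /\
     1 <= L * (drift T eps s t - 2 / coefR1 T s t)) /\
    Rabs (drift T eps s t) <= M /\
    Cmod (boundary_theta_coef T eps s g gamma t) <= M /\
    forall x, Icc 0 1 x ->
      Cmod (coefG T eps s gamma t x) <= M /\
      Cmod (Dx (coefG T eps s gamma) t x) <= M.
Proof.
intros HT Heps Hs Hsm (Dg & HDg0 & HDg) (Dga & HDga0 & HDga) Hmono.
destruct (smooth_profile T s HT Hsm) as (s2 & s3 & Hd).
assert (Hs0 : forall t, Icc 0 T t -> s t <> 0)
  by (intros t Ht; specialize (Hs t Ht); lra).
assert (Hd0 : forall t, Icc 0 T t -> sdot T s t <> 0)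
  by (intros t Ht; destruct Hmono as [H|H]; specialize (H t Ht); lra).
assert (Bs := is_derive_on_bounded T s _ (fun t Ht => proj1 (Hd t Ht))).
assert (Bd := is_derive_on_bounded T _ _ (fun t Ht => proj1 (proj2 (Hd t Ht)))).
assert (Bd2 := is_derive_on_bounded T _ _ (fun t Ht => proj2 (proj2 (Hd t Ht)))).
assert (Bsi := bounded_inv T s _ HT (fun t Ht => proj1 (Hd t Ht)) Hs0).
assert (Bdi := bounded_inv T _ _ HT (fun t Ht => proj1 (proj2 (Hd t Ht))) Hd0).
destruct (zeta_amplitude_derive T eps s s2 HT Hmono
  (fun t Ht => conj (proj1 (Hd t Ht)) (proj1 (proj2 (Hd t Ht)))) Bs Bd Bdi Bd2)
  as (c' & Bc' & Hc).
assert (Bc := is_derive_on_bounded T _ _ Hc).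
assert (Bga : bounded T (fun t x => gamma t (x * s t))).
{ apply bounded_ext with (fun t x => Dga 0%nat 0%nat (t, x * s t)).
  - intros t x Ht [Hx0 Hx1]; apply (HDga0 (t, x * s t)); split; [exact Ht|].
    specialize (Hs t Ht); split; simpl; nra.
  - exact (bounded_below_profile T s _ _ _ Hs (fun t Ht => proj1 (Hd t Ht))
      (HDga 0%nat 0%nat)). }
assert (Bgay := bounded_below_profile T s _ _ _ Hs (fun t Ht => proj1 (Hd t Ht))
      (HDga 0%nat 1%nat)).
assert (Bg : bounded T (fun t _ => g t)).
{ apply bounded_ext with (fun t _ => Dg 0%nat t).
  - intros t x Ht _; apply HDg0, Ht.
  - exact (is_derive_on_bounded_C T _ _ (HDg 0%nat)). }
assert (Bdrift : bounded T (fun t _ => RtoC (drift T eps s t))).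
{ apply bounded_ext with (fun t _ => RtoC
    (sdot T s t * / s t + zeta_amplitude T eps s t * (/ s t) ^ 2));
    [|bounded_algebra].
  intros t x Ht _; f_equal; unfold zeta_amplitude, drift; field; apply Hs0, Ht. }
assert (BG : bounded T (coefG T eps s gamma)).
{ eapply bounded_ext.
  - intros t x Ht Hx; symmetry.
    apply (coefG_eq T eps s gamma t x (c' t) HT (Hs0 t Ht) Ht Hx (Hc t Ht)).
  - eapply bounded_ext with (f := fun t x =>
      (RtoC (zeta_amplitude T eps s t * ((/ 2) * (/ s t) ^ 2))
       + Ci * RtoC ((c' t * / 2 - sdot T s t * / s t * zeta_amplitude T eps s t
            - zeta_amplitude T eps s t ^ 2 * (/ 2 * (/ s t) ^ 2)) * x ^ 2)
       + Ci * gamma t (x * s t)%R)%C); [|bounded_algebra].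
    intros t x Ht _; assert (H := Hs0 t Ht).
    f_equal; [f_equal; [f_equal; field; exact H|]]; f_equal; f_equal; field; exact H. }
assert (BGx : bounded T (Dx (coefG T eps s gamma))).
{ eapply bounded_ext.
  - intros t x Ht Hx; symmetry.
    apply (Dx_coefG T eps s gamma t x (c' t) (Dga 0%nat 1%nat (t, x * s t))
      HT (Hs0 t Ht) Ht Hx (Hc t Ht)).
    apply (is_derive_on_gamma T s gamma _ _ _ t x Ht Hx (Hs t Ht) HDga0
      (HDga 0%nat 0%nat)).
  - eapply bounded_ext with (f := fun t x =>
      (Ci * RtoC ((c' t * / 2 - sdot T s t * / s t * zeta_amplitude T eps s t
            - zeta_amplitude T eps s t ^ 2 * (/ 2 * (/ s t) ^ 2)) * (2 * x))
       + Ci * (RtoC (s t) * Dga 0%nat 1%nat (t, x * s t)%R))%C); [|bounded_algebra].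
    intros t x Ht _; assert (H := Hs0 t Ht).
    f_equal; f_equal; f_equal; field; exact H. }
assert (BG1 : bounded T (fun t _ => coefG T eps s gamma t 1)).
{ destruct BG as [M HM]; exists M; intros t x Ht _; apply HM; [exact Ht|].
  unfold Icc; lra. }
assert (Bk : bounded T (fun t _ => boundary_theta_coef T eps s g gamma t)).
{ apply bounded_ext with (fun t _ => coefG T eps s gamma t 1
    + (g t - Ci * RtoC (/ 2 * c' t))
    + Ci * RtoC (zeta_amplitude T eps s t *
                 ((1 + sdot T s t ^ 2) * (/ sdot T s t * / s t))))%C;
    [|bounded_algebra].
  intros t x Ht _; unfold boundary_theta_coef, coefR2.
  assert (I1 : Icc 0 1 1) by (unfold Icc; lra).
  rewrite (Dt_zeta T eps s t 1 (c' t) HT Ht (Hc t Ht)), Dx_zeta by exact I1.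
  assert (H1 := Hs0 t Ht); assert (H2 := Hd0 t Ht).
  assert (H3 := coefR1_neq_0 T s t H2 H1).
  assert (H4 := pow2_ge_0 (sdot T s t)).
  replace (zeta_amplitude T eps s t * ((1 + sdot T s t ^ 2) * (/ sdot T s t * / s t)))
    with (zeta_amplitude T eps s t * / coefR1 T s t)
    by (unfold coefR1; field; repeat split; try assumption; lra).
  rewrite pow1, !Rmult_1_r, !RtoC_mult, (RtoC_inv 2), (RtoC_inv _ H3) by lra.
  field; intros E; apply H3, RtoC_inj, E. }
destruct (drift_dominates T eps s Heps Hs Hmono Bs Bd Bdi) as (L & HL & Hdom).
destruct Bdrift as [M1 H1], Bk as [M2 H2], BG as [M3 H3], BGx as [M4 H4].
exists (Rmax 0 (Rmax (Rmax M1 M2) (Rmax M3 M4))), L.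
assert (N0 := Rmax_l 0 (Rmax (Rmax M1 M2) (Rmax M3 M4))).
assert (N := Rmax_r 0 (Rmax (Rmax M1 M2) (Rmax M3 M4))).
assert (N12 := Rmax_l (Rmax M1 M2) (Rmax M3 M4)).
assert (N34 := Rmax_r (Rmax M1 M2) (Rmax M3 M4)).
assert (N1 := Rmax_l M1 M2); assert (N2 := Rmax_r M1 M2).
assert (N3 := Rmax_l M3 M4); assert (N4 := Rmax_r M3 M4).
split; [exact N0|split; [exact HL|]]; intros t Ht.
assert (I0 : Icc 0 1 0) by (unfold Icc; lra).
specialize (H1 t 0 Ht I0); rewrite Cmod_R in H1; specialize (H2 t 0 Ht I0).
split; [apply Hdom, Ht|split; [lra|split; [lra|]]].
intros x Hx; specialize (H3 t x Ht Hx); specialize (H4 t x Ht Hx); split; lra.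
Qed.

(** * Stability *)

Theorem theorem3p1 (T eps : R) (s : R -> R) (g : R -> C)
    (gamma : R -> R -> C)
    (HT : 0 < T)
    (Heps : 0 < eps)
    (Hspos : forall t, Icc 0 T t -> 0 < s t)
    (Hs : smooth_on (V := R_NormedModule) 0 T s)
    (Hg : smooth_on (V := C_R_NormedModule) 0 T g)
    (Hgamma : smooth_on2 (profile_region T s) gamma)
    (Hmono : (forall t, Icc 0 T t -> 0 < sdot T s t) \/
             (forall t, Icc 0 T t -> sdot T s t < 0)) :
  exists K : R,
    forall (w0 : R -> C) (p : R -> R -> C),
      smooth_on (V := C_R_NormedModule) 0 (s 0) w0 ->
      is_solution T eps s g gamma (p0 T eps s w0) p ->
      forall t, Icc 0 T t ->
        L2norm (p t) <= K * L2norm (p0 T eps s w0).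
Proof.
destruct (coefficients_bounded T eps s g gamma HT Heps Hspos Hs Hg Hgamma Hmono)
  as (M & L & HM & HL & Hcoef).
pose (N := M ^ 2 * L).
assert (HN : 0 <= N) by (apply Rmult_le_pos; [apply pow2_ge_0|exact HL]).
exists (sqrt (exp ((5 * M + N) * T))); intros w0 p _ [Hreg Hpde Hl Hr Hi] t Ht.
assert (Hs0 : forall t, Icc 0 T t -> s t <> 0)
  by (intros t' Ht'; specialize (Hspos t' Ht'); lra).
assert (Hd0 : forall t, Icc 0 T t -> sdot T s t <> 0)
  by (intros t' Ht'; destruct Hmono as [H|H]; specialize (H t' Ht'); lra).
assert (HA : forall t, Icc 0 T t -> coefA s t <> 0).
{ intros t' Ht'; unfold coefA; assert (H := pow_nonzero _ 2 (Hs0 t' Ht')); lra. }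
assert (HE : energy p t <= exp ((5 * M + N) * t) * energy p 0).
{ apply (energy_estimate T M N (fun t => / coefA s t) (drift T eps s)
    (fun t => / coefR1 T s t) (boundary_theta_coef T eps s g gamma)
    (coefG T eps s gamma) (Dx (coefG T eps s gamma)) p);
    [exact HT| | | |exact HN|exact Hreg| |exact Hl| |exact Ht].
  - intros t' Ht'; apply Hcoef, Ht'.
  - intros t' x Ht'; apply Hcoef, Ht'.
  - intros t' z w Ht'; destruct (Hcoef t' Ht') as ([H1 H2] & _ & H3 & _).
    replace (2 * / coefR1 T s t' - drift T eps s t')
      with (- (drift T eps s t' - 2 / coefR1 T s t')) by (unfold Rdiv; ring).
    apply boundary_dissipation; assumption.
  - intros t' x Ht' Hx; rewrite Hpde by assumption.
    rewrite coefB_eq, Dx_coefB, (RtoC_inv _ (HA t' Ht')) by auto; reflexivity.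
  - intros t' Ht'; assert (Hr' := Hr t' Ht'); cbv zeta in Hr'.
    assert (I1 : Icc 0 1 1) by (unfold Icc; lra).
    rewrite coefB_eq in Hr' by auto; rewrite (RtoC_inv _ (HA t' Ht')).
    assert (H1 := coefR1_neq_0 T s t' (Hd0 t' Ht') (Hs0 t' Ht')).
    unfold boundary_theta_coef.
    rewrite RtoC_minus, (RtoC_inv _ H1).
    change (Ci * / RtoC (coefA s t'))%C with (Ci / RtoC (coefA s t'))%C.
    rewrite Hr', Rmult_1_l; f_equal; field.
    intros E; apply H1, RtoC_inj, E. }
assert (HE0 : energy p 0 = energy (fun _ => p0 T eps s w0) 0).
{ apply RInt_ext; rewrite Rmin_left, Rmax_right by lra; intros x Hx.
  rewrite Hi by (unfold Icc; lra); reflexivity. }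
change (sqrt (energy p t) <= sqrt (exp ((5 * M + N) * T))
        * sqrt (energy (fun _ => p0 T eps s w0) 0)).
rewrite <- HE0, <- sqrt_mult_alt by (apply Rlt_le, exp_pos).
apply sqrt_le_1_alt, Rle_trans with (1 := HE), Rmult_le_compat_r.
- apply (energy_ge_0 T); [unfold Icc; lra|apply Hreg].
- destruct Ht as [_ Ht]; destruct (Rle_lt_or_eq_dec _ _ Ht) as [Hlt| ->]; [|lra].
  destruct (Rle_lt_or_eq_dec 0 (5 * M + N)) as [Hp|Hp]; [lra| |].
  + apply Rlt_le, exp_increasing, Rmult_lt_compat_l; assumption.
  + rewrite <- Hp, !Rmult_0_l; lra.
Qed.
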